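(* Let $\theta\in\mathbb R$. (i) \[\limsup_{\epsilon\to+0}\frac{1}{\epsilon^2}\left(\limsup_{n\to\infty}\frac{\log P(|\hat\theta_n-\theta|>\epsilon)}{n}\right)\le-\frac{m(2m-1)}{2(m+1)}\] and \[\liminf_{\epsilon\to+0}\frac{1}{\epsilon^2}\left(\liminf_{n\to\infty}\frac{\log P(|\hat\theta_n-\theta|>\epsilon)}{n}\right)\ge-\frac{m(2m-1)}{2(m+1)}.\] (ii) For every sequence $(\lambda_n)_n$ of positive numbers with $\lambda_n\to\infty$ and $\lambda_n/n^{1/2}\to0$, and every $\epsilon>0$, \[\lim_{n\to\infty}\frac{\log P(|\hat\theta_n-\theta|>\epsilon/\lambda_n)}{n/\lambda_n^2}=-\frac{m(2m-1)}{2(m+1)}\epsilon^2.\]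
   Context: Fix $m>1/2$. Let $c_m:=\left(\int_{\mathbb R}(1+x^2)^{-m}\,dx\right)^{-1}$ and $f(x):=c_m(1+x^2)^{-m}$. For $\theta\in\mathbb R$, $\mathrm{PVII}_m(\theta,1)$ denotes the Pearson Type VII distribution with location $\theta$ and scale $1$, i.e. the law with density $x\mapsto f(x-\theta)$. Let $(X_n)_{n\ge1}$ be i.i.d. random variables on a probability space $(\Omega,\mathcal F,P)$ with law $\mathrm{PVII}_m(\theta,1)$. For each $n$, let $\hat\theta_n(x_1,\dots,x_n)$ be any Borel measurable function on $\mathbb R^n$ such that $\hat\theta_n(x_1,\dots,x_n)$ is a maximizer of $t\mapsto\prod_{i=1}^n f(x_i-t)$ over $t\in\mathbb R$, and let $\hat\theta_n:=\hat\theta_n(X_1,\dots,X_n)$ (the maximum likelihood estimator). *)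

(* Defs.v *)
From HB Require Import structures.
From mathcomp Require Import all_boot all_order all_algebra.
From mathcomp Require Import all_classical all_reals all_analysis.
Set Implicit Arguments. Unset Strict Implicit. Unset Printing Implicit Defensive.
Import Order.TTheory GRing.Theory Num.Theory.
Import numFieldNormedType.Exports.
Local Open Scope classical_set_scope.
Local Open Scope ring_scope.

Section Defs.
Variable R : realType.

Definition pvii_const (m : R) : R :=
  (fine (\int[@lebesgue_measure R]_x ((1 + x ^+ 2) `^ (- m))%:E))^-1.

Definition pvii_density (m : R) (x : R) : R :=
  pvii_const m * (1 + x ^+ 2) `^ (- m).

Definition Rn_borel (n : nat) : set (set ('I_n -> R)) :=
  <<s [set [set x : 'I_n -> R | forall i, B i (x i)] |
        B in [set B : 'I_n -> set R | forall i, measurable (B i)]] >>.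

Definition Rn_borel_measurable (n : nat) (g : ('I_n -> R) -> R) : Prop :=
  forall A : set R, measurable A -> @Rn_borel n (g @^-1` A).

Definition mutually_independent d (T : measurableType d)
    (P : probability T R) (X : nat -> T -> R) : Prop :=
  forall (J : seq nat) (B : nat -> set R),
    uniq J -> (forall i, measurable (B i)) ->
    P (\bigcap_(i in [set i | i \in J]) (X i @^-1` B i)) =
    (\prod_(i <- J) P (X i @^-1` B i))%E.

Definition has_law_PVII d (T : measurableType d) (P : probability T R)
    (m theta : R) (Y : T -> R) : Prop :=
  forall B : set R, measurable B ->
    P (Y @^-1` B) =
    (\int[@lebesgue_measure R]_(x in B) (pvii_density m (x - theta))%:E)%E.

Definition is_mle (m : R) (n : nat) (x : 'I_n -> R) (t : R) : Prop :=
  forall s : R, \prod_(i < n) pvii_density m (x i - s)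
                <= \prod_(i < n) pvii_density m (x i - t).

End Defs.

(* Main.v *)
Require Import Defs.
From HB Require Import structures.
From mathcomp Require Import all_boot all_order all_algebra.
From mathcomp Require Import all_classical all_reals all_analysis.
From mathcomp Require Import measurable_realfun ring lra.
Set Implicit Arguments. Unset Strict Implicit. Unset Printing Implicit Defensive.
Import Order.TTheory GRing.Theory Num.Theory.
Import numFieldNormedType.Exports.
Local Open Scope classical_set_scope.
Local Open Scope ring_scope.

(** Put [rho x = ln (1 + x^2)] and [psi = rho' / 2]; the estimator minimizes
    [sum_i rho (x_i - t)].  Write [a = E psi'(X)], so that [E psi(X) = 0],
    [E psi(X)^2 = a / (2 m)] and the rate is [- b] with [b = m a].

    Upper bound: if the estimation error [t] exceeds [e] in absolute value, then a
    product [prod_i g (x_i)] is at least 1 for some [g] in an explicit finite family.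
    For [t] slightly above [e], a second order expansion of the likelihood forces the
    score [sum_i psi (x_i - e)] to be nonnegative unless the empirical curvature is
    abnormally small; for moderate [t] a grid of Hellinger affinities does the job, and
    for large [t] Peetre's inequality [1 + t^2 <= 2 (1 + x^2) (1 + (x - t)^2)].  All these
    [g] have mean at most some [r < 1] independent of [e], except the tilted scores,
    whose mean is [1 - b e^2 + O(e^3)].  Markov's inequality concludes.

    Lower bound: change the centre from [theta] to [theta + (1 + eta) e].  Under the new
    law the upper bound makes the error from [theta] larger than [e] with probability
    near 1, and the log-likelihood ratio is at most [n (b + eta) ((1 + eta) e)^2] up to
    an event that is again controlled by a product.

    Both bounds hold uniformly as soon as [e] is small and [n e^2] is large, which
    covers fixed [e] and [e / lam_n] alike. *)

(** * Pointwise expansions *)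

Section Pointwise.
Variable R : realType.
Implicit Types x y h : R.

Definition psi x : R := x / (1 + x ^+ 2).
Definition dpsi x : R := (1 - x ^+ 2) / (1 + x ^+ 2) ^+ 2.
Definition rho x : R := ln (1 + x ^+ 2).

Lemma onesq_gt0 x : 0 < 1 + x ^+ 2.
Proof. by rewrite ltr_pwDl// sqr_ge0. Qed.

Lemma onesq_neq0 x : 1 + x ^+ 2 != 0.
Proof. exact/lt0r_neq0/onesq_gt0. Qed.

Hint Resolve onesq_gt0 onesq_neq0 : core.

Lemma psi_bound x : `|psi x| <= 1 / 2.
Proof.
rewrite /psi normrM normfV (gtr0_norm (onesq_gt0 x)) ler_pdivrMr//.
rewrite -real_normK ?num_real//; set u := `|x|.
have : 0 <= (u - 1) ^+ 2 by exact: sqr_ge0.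
by nra.
Qed.

(** The remainder is exactly [h ^+ 2] times a rational function of [x] and [x + h], so the estimate
    is pure algebra; [psi_bound] at both points gives [1 / 2 + 1]. *)
Lemma psi_taylor x h : `|psi (x + h) - psi x - h * dpsi x| <= 3 / 2 * h ^+ 2.
Proof.
set y := x + h.
have -> : psi y - psi x - h * dpsi x =
    h ^+ 2 * (psi y * (x ^+ 2 - 1) / (1 + x ^+ 2) ^+ 2
              - 2 * psi x * ((1 + x ^+ 2)^-1 * (1 + y ^+ 2)^-1)).
  have -> : h = y - x by rewrite /y addrAC subrr add0r.
  by rewrite /psi /dpsi; field; rewrite !onesq_neq0.
rewrite normrM ger0_norm ?sqr_ge0// mulrC ler_wpM2r ?sqr_ge0//.
have inv01 (z : R) : 0 <= (1 + z ^+ 2)^-1 <= 1.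
  by apply/andP; split; [rewrite invr_ge0 ltW|rewrite invf_le1// lerDl sqr_ge0].
have h1 : `|(x ^+ 2 - 1) / (1 + x ^+ 2) ^+ 2| <= 1.
  rewrite normrM normfV (ger0_norm (sqr_ge0 (1 + _))) ler_pdivrMr ?exprn_gt0//.
  rewrite mul1r ler_norml; have := sqr_ge0 x; set w := x ^+ 2 => w0.
  by apply/andP; split; nra.
have h2 : `|(1 + x ^+ 2)^-1 * (1 + y ^+ 2)^-1| <= 1.
  have /andP[? ?] := inv01 x; have /andP[? ?] := inv01 y.
  by rewrite ger0_norm ?mulr_ge0// mulr_ile1.
rewrite (le_trans (ler_normB _ _))// -(mulrA (psi y)) (normrM (psi y)).
rewrite -(mulrA 2 (psi x)) (normrM 2) (normrM (psi x)) (ger0_norm (_ : 0 <= 2 :> R))//.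
have hx := psi_bound x; have hy := psi_bound y.
have := ler_pM (normr_ge0 _) (normr_ge0 _) hx h2.
have := ler_pM (normr_ge0 _) (normr_ge0 _) hy h1.
lra.
Qed.

(** Adding the expansions from [x] to [x + h] and back leaves [h] times the difference of the
    derivatives, at most [3 * h ^+ 2] in absolute value. *)
Lemma dpsi_lipschitz x h : `|dpsi (x + h) - dpsi x| <= 3 * `|h|.
Proof.
have [->|h0] := eqVneq h 0; first by rewrite addr0 subrr normr0 mulr0.
have h1 := psi_taylor x h; have h2 := psi_taylor (x + h) (- h).
rewrite addrK sqrrN in h2.
have h3 : `|h| * `|dpsi (x + h) - dpsi x| <= `|h| * (3 * `|h|).
  rewrite -normrM mulrCA -expr2 real_normK ?num_real//.
  have := le_trans (ler_normD _ _) (lerD h1 h2).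
  rewrite (_ : psi (x + h) - psi x - h * dpsi x +
     (psi x - psi (x + h) - - h * dpsi (x + h)) =
     h * (dpsi (x + h) - dpsi x)); last by ring.
  by move/le_trans; apply; lra.
by rewrite ler_pM2l ?normr_gt0 in h3.
Qed.

Lemma dpsi_bound x : `|dpsi x| <= 1.
Proof.
rewrite /dpsi normrM normfV (ger0_norm (sqr_ge0 (1 + _))) ler_pdivrMr ?exprn_gt0//.
rewrite mul1r ler_norml; have := sqr_ge0 x; set w := x ^+ 2 => w0.
by apply/andP; split; nra.
Qed.

(** Raises the order of a Taylor estimate by one: a bound on the derivative of a remainder over the
    ball of radius [|h|] becomes a bound on the remainder itself. *)
Lemma mean_value_bound (F dF : R -> R) (h K : R) :
  (forall u : R, is_derive u 1 F (dF u)) ->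
  (forall u, `|u| <= `|h| -> `|dF u| <= K) ->
  `|F h - F 0| <= K * `|h|.
Proof.
move=> dFP bF.
have cF : continuous F.
  by move=> u; apply/differentiable_continuous/derivable1_diffP; have [] := dFP u.
have aux a b : a <= b -> {within `[a, b], continuous F} by move=> _; exact: continuous_subspaceT.
have [h0|/ltW h0] := leP 0 h.
- have [c + ->] := MVT_segment h0 (fun u _ => dFP u) (aux _ _ h0).
  rewrite in_itv/= => /andP[c0 ch]; rewrite subr0 normrM ler_wpM2r// bF//.
  by rewrite !ger0_norm// (le_trans c0).
- have [c + e] := MVT_segment h0 (fun u _ => dFP u) (aux _ _ h0).
  rewrite in_itv/= => /andP[c0 ch].
  rewrite distrC e sub0r normrM normrN ler_wpM2r// bF//.
  by rewrite !ler0_norm// lerN2.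
Qed.

Global Instance is_derive_rho_shift x h :
  is_derive h 1 (fun h => rho (x + h)) (2 * psi (x + h)).
Proof.
have d1 : is_derive h 1 (fun h => 1 + (x + h) ^+ 2) (2 * (x + h)).
  rewrite (_ : (fun h => _) = cst 1 + (cst x + id) ^+ 2)//.
  by apply: is_derive_eq; rewrite /GRing.scale/= fctE /=; ring.
rewrite (_ : (fun h => _) = @ln R \o (fun h => 1 + (x + h) ^+ 2))//.
have dl := is_derive1_ln (onesq_gt0 (x + h)).
have := @is_derive1_comp R (@ln R) (fun h => 1 + (x + h) ^+ 2) h _ _ dl d1.
by move=> H; apply: (is_derive_eq H); rewrite /psi /GRing.scale/=; ring.
Qed.

Lemma rho_lipschitz x h : `|rho (x + h) - rho x| <= `|h|.
Proof.
have := @mean_value_bound (fun h => rho (x + h)) (fun h => 2 * psi (x + h)) h 1.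
rewrite addr0 mul1r; apply => u _.
by rewrite normrM ger0_norm//; have := psi_bound (x + u); lra.
Qed.

(** The remainder, as a function of [h], has derivative [2 * (psi (x + h) - psi x - h * dpsi x)],
    which [psi_taylor] controls. *)
Lemma rho_taylor x h :
  `|rho (x + h) - rho x - 2 * h * psi x - h ^+ 2 * dpsi x| <= 3 * `|h| ^+ 3.
Proof.
pose F := (fun h => rho (x + h)) - cst (rho x) - cst (2 * psi x) * id
          - cst (dpsi x) * (id ^+ 2) : R -> R.
have := @mean_value_bound F (fun h => 2 * (psi (x + h) - psi x - h * dpsi x)) h
  (3 * `|h| ^+ 2).
have FE u : F u = rho (x + u) - rho x - 2 * u * psi x - u ^+ 2 * dpsi x.
  by rewrite /F !fctE; ring.
rewrite !FE (_ : _ - (rho (x + 0) - _ - _ - _) =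
   rho (x + h) - rho x - 2 * h * psi x - h ^+ 2 * dpsi x); last first.
  by rewrite addr0; ring.
rewrite (_ : _ * `|h| = 3 * `|h| ^+ 3); last by ring.
apply.
  by move=> u; apply: is_derive_eq; rewrite /GRing.scale/=; ring.
move=> u uh; rewrite normrM (ger0_norm (_ : 0 <= 2 :> R))//.
have := psi_taylor x u; rewrite -(@real_normK _ u) ?num_real//.
have : `|u| ^+ 2 <= `|h| ^+ 2 by rewrite lerXn2r// nnegrE.
lra.
Qed.

Lemma expR_le2 y : y <= 1 / 2 -> expR y <= 2.
Proof.
move=> y2; have := expR_ge1Dx (- y); rewrite expRN => h.
have /andP[e0] : 0 < expR y <= (1 - y)^-1.
  by rewrite expR_gt0/= -[X in X <= _]invrK lef_pV2// posrE ?invr_gt0 ?expR_gt0//; lra.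
move/le_trans; apply; rewrite -[leRHS]invrK lef_pV2 ?posrE//; lra.
Qed.

Let ball_half u y : `|u| <= `|y| -> `|y| <= 1 / 2 -> u <= 1 / 2.
Proof. by move=> h1 h2; rewrite (le_trans (ler_norm u))// (le_trans h1). Qed.

Lemma expR_taylor0 y : `|y| <= 1 / 2 -> `|expR y - 1| <= 2 * `|y|.
Proof.
move=> y2; have := @mean_value_bound expR expR y 2; rewrite expR0; apply.
by move=> u uy; rewrite ger0_norm ?expR_ge0// expR_le2// (ball_half uy).
Qed.

Lemma expR_taylor1 y : `|y| <= 1 / 2 -> `|expR y - 1 - y| <= 2 * `|y| ^+ 2.
Proof.
move=> y2; pose F := expR - cst 1 - id : R -> R.
have := @mean_value_bound F (fun h => expR h - 1) y (2 * `|y|).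
rewrite /F /= !fctE expR0 subrr !subr0 expr2 mulrA; apply.
  by move=> u; apply: is_derive_eq; rewrite subr0.
move=> u uy; rewrite (le_trans (expR_taylor0 _))// ?(le_trans uy)//.
by rewrite ler_pM2l.
Qed.

Lemma expR_taylor2 y : `|y| <= 1 / 2 ->
  `|expR y - 1 - y - y ^+ 2 / 2| <= 2 * `|y| ^+ 3.
Proof.
move=> y2; pose F := expR - cst 1 - id - cst (2^-1) * id ^+ 2 : R -> R.
have := @mean_value_bound F (fun h => expR h - 1 - h) y (2 * `|y| ^+ 2).
rewrite /F /= !fctE expR0 subrr /GRing.scale/= !(expr0n,mulr0,subr0)/= (mulrC (2^-1)).
rewrite (_ : _ * `|y| = 2 * `|y| ^+ 3); last by ring.
apply.
  by move=> u; apply: is_derive_eq; rewrite /GRing.scale/=; field.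
move=> u uy; rewrite (le_trans (expR_taylor1 _))// ?(le_trans uy)//.
by rewrite ler_pM2l// lerXn2r// nnegrE.
Qed.

End Pointwise.

(** * Integrals of powers of [1 + x^2] *)

Section Weight.
Variable R : realType.
Implicit Types k x : R.
Let mu := @lebesgue_measure R.

(** This is [(1 + x^2)^(-k)], written as an exponential so that multiplying weights or tilting the
    density only adds exponents. *)
Definition weight k x : R := expR (- k * rho x).

Lemma weight_gt0 k x : 0 < weight k x. Proof. exact: expR_gt0. Qed.
Lemma weight_ge0 k x : 0 <= weight k x. Proof. exact: expR_ge0. Qed.

Lemma powR_weight k x : (1 + x ^+ 2) `^ (- k) = weight k x.
Proof. by rewrite /powR gt_eqF ?onesq_gt0. Qed.

Lemma rhoN x : rho (- x) = rho x. Proof. by rewrite /rho sqrrN. Qed.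

Lemma expR_rho x : expR (rho x) = 1 + x ^+ 2.
Proof. by rewrite lnK// posrE onesq_gt0. Qed.

Lemma weight_add k l x : weight (k + l) x = weight k x * weight l x.
Proof. by rewrite /weight opprD mulrDl expRD. Qed.

Lemma weight1 x : weight 1 x = (1 + x ^+ 2)^-1.
Proof. by rewrite /weight mulN1r expRN expR_rho. Qed.

Lemma is_derive_rho (x : R) : is_derive x 1 (@rho R) (2 * psi x).
Proof.
rewrite -{2}[x]add0r (_ : @rho R = (fun h => rho (0 + h))); last first.
  by apply/funext => y; rewrite add0r.
exact: is_derive_rho_shift.
Qed.

Lemma is_derive_continuous (F dF : R -> R) :
  (forall x : R, is_derive x 1 F (dF x)) -> continuous F.
Proof.
by move=> h x; apply/differentiable_continuous/derivable1_diffP; have [] := h x.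
Qed.

Lemma rho_continuous : continuous (@rho R).
Proof. exact: is_derive_continuous is_derive_rho. Qed.

Lemma is_derive_weight k x :
  is_derive x 1 (weight k) (weight k x * (- (2 * k) * psi x)).
Proof.
have h1 : is_derive x 1 (cst (- k) * @rho R) (- k * (2 * psi x)).
  have := is_derive_rho x => h.
  by apply: is_derive_eq; rewrite /GRing.scale/=; ring.
have := @is_derive1_comp R expR (cst (- k) * @rho R) x _ _ (is_derive_expR _) h1.
by move=> H; apply: (is_derive_eq H); rewrite /weight /GRing.scale/= fctE; ring.
Qed.

Lemma weight_continuous k : continuous (weight k).
Proof. exact: is_derive_continuous (is_derive_weight k). Qed.

Lemma weight_measurable k (D : set R) : measurable_fun D (weight k).
Proof.
by apply: measurable_funTS; apply: continuous_measurable_fun; exact: weight_continuous.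
Qed.

Lemma weightN k x : weight k (- x) = weight k x.
Proof. by rewrite /weight rhoN. Qed.

Lemma cvg_expR_ln (c : R) : 0 < c -> expR (- c * ln (1 + x)) @[x --> +oo] --> (0 : R).
Proof.
move=> c0; apply/cvgr0Pnorm_lt => e e0.
have [y ye] : exists y, expR (- y) <= e / 2.
  by exists (- ln (e / 2)); rewrite opprK lnK// posrE divr_gt0.
near=> x; rewrite ger0_norm ?expR_ge0//.
apply: (@le_lt_trans _ _ (e / 2)); last by lra.
apply: le_trans ye; rewrite ler_expR mulNr lerN2 mulrC -ler_pdivrMr//.
rewrite -[leLHS]expRK ler_ln ?posrE ?expR_gt0//.
  by rewrite -lerBlDl; near: x; apply: nbhs_pinfty_ge; rewrite num_real.
rewrite -ltrBlDl sub0r; near: x; apply: nbhs_pinfty_gt; exact: num_real.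
Unshelve. all: by end_near. Qed.

(** The translated measure has the right values on half-open intervals, and these determine Lebesgue
    measure. *)
Lemma lebesgue_measure_shift (s : R) (A : set R) : measurable A ->
  pushforward mu (fun x : measurableTypeR R => (x - s : measurableTypeR R)) A = mu A.
Proof.
have mshift : measurable_fun setT
    (fun x : measurableTypeR R => (x - s : measurableTypeR R)).
  exact: measurable_funB.
pose nu := pushforward mu (fun x : measurableTypeR R => (x - s : measurableTypeR R)).
move=> mA; apply/esym/(@lebesgue_measure_unique _ nu) => //= _ [[a b]] _ <-.
rewrite /nu /pushforward.
rewrite (_ : _ @^-1` _ = `](a + s), (b + s)]%classic); last first.
  by apply/seteqP; split => x /=; rewrite !in_itv/= ltrBrDr lerBlDr.
rewrite !lebesgue_measure_itv/= !lte_fin ltrD2r -!EFinB.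
by rewrite (_ : b + s - (a + s) = b - a)//; ring.
Qed.

Lemma ge0_integral_shift (s : R) (G : R -> R) :
  measurable_fun setT G -> (forall x, 0 <= G x) ->
  (\int[mu]_x (G (x - s))%:E = \int[mu]_x (G x)%:E)%E.
Proof.
move=> mG G0.
have mshift : measurable_fun setT
    (fun x : measurableTypeR R => (x - s : measurableTypeR R)).
  exact: measurable_funB.
rewrite -[LHS](@ge0_integral_pushforward _ _ _ _ _ _ mshift mu setT (EFin \o G))//.
- by apply: eq_measure_integral => A mA _; exact: lebesgue_measure_shift.
- exact/measurable_EFinP.
- by move=> x _; rewrite lee_fin.
Qed.

Lemma ge0_integral_opp (G : R -> R) :
  measurable_fun setT G -> (forall x, 0 <= G x) ->
  (\int[mu]_x (G (- x))%:E = \int[mu]_x (G x)%:E)%E.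
Proof.
move=> mG G0.
have mopp : measurable_fun setT (-%R : measurableTypeR R -> measurableTypeR R).
  exact: oppr_measurable.
rewrite -[LHS](@ge0_integral_pushforward _ _ _ _ _ _ mopp mu setT (EFin \o G))//.
- by apply: eq_measure_integral => A mA _; exact: lebesgue_measureN.
- exact/measurable_EFinP.
- by move=> x _; rewrite lee_fin.
Qed.

(** * Convergence and recurrence of the weight integrals *)

Section Moments.
Variable k : R.
Hypothesis hk : 1 / 2 < k.

Let k1 : 0 < 2 * k - 1. Proof. by move: hk; lra. Qed.

(* [(1 + x)^(-2k)] dominates [2^(-k) (1 + x^2)^(-k)] and has an explicit primitive. *)
Let tail x := expR (- (2 * k) * ln (1 + x)).
Let tailp x := - (2 * k - 1)^-1 * expR (- (2 * k - 1) * ln (1 + x)).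

Let d_ln1 x : 0 <= x -> is_derive x 1 (fun x : R => ln (1 + x)) (1 + x)^-1.
Proof.
move=> x0; have x1 : 0 < 1 + x by lra.
have h1 : is_derive x 1 (cst 1 + id : R -> R) 1.
  by apply: is_derive_eq; rewrite add0r.
have := @is_derive1_comp R (@ln R) (cst 1 + id) x _ _ (is_derive1_ln x1) h1.
by move=> H; apply: (is_derive_eq H); rewrite /GRing.scale/= mulr1.
Qed.

Let d_expln c x : 0 <= x ->
  is_derive x 1 (fun x : R => expR (c * ln (1 + x))) (c * expR ((c - 1) * ln (1 + x))).
Proof.
move=> x0; have x1 : 0 < 1 + x by lra.
have h1 : is_derive x 1 (cst c * (fun x => ln (1 + x))) (c * (1 + x)^-1).
  have := d_ln1 x0 => h.
  by apply: is_derive_eq; rewrite /GRing.scale/=; ring.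
have := @is_derive1_comp R expR (cst c * (fun x => ln (1 + x))) x _ _ (is_derive_expR _) h1.
move=> H; apply: (is_derive_eq H); rewrite /GRing.scale/= !fctE.
by rewrite mulrBl expRB mul1r lnK ?posrE//; ring.
Qed.

Let d_tailp x : 0 <= x -> is_derive x 1 tailp (tail x).
Proof.
move=> x0; have h := @d_expln (- (2 * k - 1)) x x0.
have H : is_derive x 1 (cst (- (2 * k - 1)^-1) *
   (fun x : R => expR (- (2 * k - 1) * ln (1 + x)))) (tail x).
  apply: is_derive_eq; rewrite /tail /GRing.scale/=.
  rewrite (_ : - (2 * k - 1) - 1 = - (2 * k)); last by ring.
  by field; rewrite gt_eqF.
exact: H.
Qed.

Let weight_tail x : 0 <= x -> weight k x <= expR (k * ln 2) * tail x.
Proof.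
move=> x0; rewrite /weight /tail -expRD ler_expR.
have : rho x + ln 2 >= 2 * ln (1 + x).
  rewrite /rho mulr_natl -lnXn; last lra.
  rewrite -lnM ?posrE ?onesq_gt0// ler_ln ?posrE ?exprn_gt0 ?mulr_gt0 ?onesq_gt0//; last lra.
  by have := sqr_ge0 (x - 1); nra.
by move: hk => hk' /(ler_wpM2l (_ : 0 <= k)) => /(_ ltac:(lra)); lra.
Qed.

Let c2 := expR (k * ln 2).
(** The derivative of [x * weight k x] carries the recurrence but changes sign. Adding a multiple of
    the primitive [tailp] makes the derivative [D] nonnegative, so that the fundamental theorem of
    calculus applies on the half-line. *)
Let H x := x * weight k x + c2 * (2 * k - 1) * tailp x.
Let D x := 2 * k * weight (k + 1) x + c2 * (2 * k - 1) * tail x - (2 * k - 1) * weight k x.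

Let d_H x : 0 <= x -> is_derive x 1 H (D x).
Proof.
move=> x0; have h1 := is_derive_weight k x; have h2 := d_tailp x0.
have HH : is_derive x 1 (id * weight k + cst (c2 * (2 * k - 1)) * tailp) (D x).
  apply: is_derive_eq; rewrite /D /GRing.scale/= weight_add weight1 /psi.
  by field; exact: onesq_neq0.
exact: HH.
Qed.

Let D_ge0 x : 0 <= x -> 0 <= D x.
Proof.
move=> x0; have h := weight_tail x0; rewrite /D -/c2.
have : (2 * k - 1) * weight k x <= (2 * k - 1) * (c2 * tail x) by rewrite ler_pM2l.
have : 0 <= 2 * k * weight (k + 1) x by rewrite mulr_ge0 ?weight_ge0//; move: hk; lra.
lra.
Qed.

Let cvg_tailp : tailp x @[x --> +oo] --> (0 : R).
Proof.
rewrite -(mulr0 (- (2 * k - 1)^-1)); apply: cvgM; first exact: cvg_cst.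
exact: cvg_expR_ln.
Qed.

Let weight_rate x : 0 <= x -> x * weight k x <= c2 * expR (- (2 * k - 1) * ln (1 + x)).
Proof.
move=> x0; apply: (@le_trans _ _ ((1 + x) * (c2 * tail x))).
  by rewrite ler_pM ?weight_ge0 ?weight_tail//; lra.
rewrite mulrCA ler_pM2l ?expR_gt0// /tail -{1}(@lnK _ (1 + x)) ?posrE; last lra.
by rewrite -expRD ler_expR; lra.
Qed.

Let cvg_xweight : x * weight k x @[x --> +oo] --> (0 : R).
Proof.
apply: (@squeeze_cvgr _ _ _ _ (cst 0) (fun x => c2 * expR (- (2 * k - 1) * ln (1 + x)))).
- near=> x; apply/andP; split; last apply: weight_rate.
    by rewrite mulr_ge0 ?weight_ge0//; near: x; apply: nbhs_pinfty_ge; exact: num_real.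
  by near: x; apply: nbhs_pinfty_ge; exact: num_real.
- exact: cvg_cst.
- by rewrite -(mulr0 c2); apply: cvgM; [exact: cvg_cst|exact: cvg_expR_ln].
Unshelve. all: by end_near. Qed.

Let cvg_H : H x @[x --> +oo] --> (0 : R).
Proof.
rewrite -(addr0 0) -{2}(mulr0 (c2 * (2 * k - 1))); apply: cvgD => //.
by apply: cvgM; [exact: cvg_cst|].
Qed.

Let ftc (F dF : R -> R) : (forall x, 0 <= x -> is_derive x 1 F (dF x)) ->
  {in `[0, +oo[, continuous dF} -> (forall x, 0 <= x -> 0 <= dF x) ->
  F x @[x --> +oo] --> (0 : R) ->
  (\int[mu]_(x in `[0%R, +oo[) (dF x)%:E = (- F 0)%:E)%E.
Proof.
move=> dFP cdF dF0 Fl; rewrite (@ge0_continuous_FTC2y _ dF F 0 0)//.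
- by rewrite -EFinB sub0r.
- by apply: continuous_in_subspaceT => x; rewrite inE/=; exact: cdF.
- by move=> x /ltW x0; have [] := dFP x x0.
- apply: cvg_at_right_filter; apply/differentiable_continuous/derivable1_diffP.
  by have [] := dFP 0 (lexx 0).
- move=> x; rewrite in_itv/= andbT => /ltW x0.
  by rewrite derive1E; have [_ ->] := dFP x x0.
Qed.

Let is_derive_continuousx (F : R -> R) (x dx : R) : is_derive x 1 F dx -> {for x, continuous F}.
Proof. by move=> [h _]; apply/differentiable_continuous/derivable1_diffP. Qed.

Let tail_continuous : {in `[0, +oo[, continuous tail}.
Proof.
by move=> x; rewrite in_itv/= andbT => x0; exact: is_derive_continuousx (d_expln _ x0).
Qed.

Let D_continuous : {in `[0, +oo[, continuous D}.
Proof.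
move=> x x0; rewrite /D; apply: cvgB; last first.
  by apply: cvgM; [exact: cvg_cst|exact: weight_continuous].
apply: cvgD; first by apply: cvgM; [exact: cvg_cst|exact: weight_continuous].
by apply: cvgM; [exact: cvg_cst|exact: tail_continuous].
Qed.

Let ln10 : ln (1 + 0) = 0 :> R. Proof. by rewrite addr0 ln1. Qed.

Let int_tail : (\int[mu]_(x in `[0%R, +oo[) (tail x)%:E = ((2 * k - 1)^-1)%:E)%E.
Proof.
rewrite (ftc d_tailp tail_continuous _ cvg_tailp)//; last by move=> x _; exact: expR_ge0.
by rewrite /tailp ln10 mulr0 expR0 mulr1 opprK.
Qed.

Let int_D : (\int[mu]_(x in `[0%R, +oo[) (D x)%:E = c2%:E)%E.
Proof.
rewrite (ftc d_H D_continuous D_ge0 cvg_H)//; congr EFin.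
rewrite /H /tailp ln10 mulr0 expR0 mul0r mulr1 add0r.
by field; rewrite gt_eqF.
Qed.

Let half : set R := `[0%R, +oo[%classic.
Let mhalf : measurable half. Proof. exact: measurable_itv. Qed.
Let hx x : half x -> 0 <= x. Proof. by rewrite /half/= in_itv/= andbT. Qed.

Let mEF (F : R -> R) : {in `[0, +oo[, continuous F} -> measurable_fun half (EFin \o F).
Proof.
move=> cF; apply/measurable_EFinP; apply: subspace_continuous_measurable_fun => //.
by apply: continuous_in_subspaceT => x; rewrite inE/=; exact: cF.
Qed.

Let mw l : measurable_fun half (EFin \o weight l).
Proof. by apply/measurable_EFinP; exact: weight_measurable. Qed.

Let half_lty : (\int[mu]_(x in half) (weight k x)%:E < +oo)%E.
Proof.
apply: (@le_lt_trans _ _ (\int[mu]_(x in half) (c2%:E * (tail x)%:E))%E).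
  apply: ge0_le_integral => //=.
  - by move=> x _; rewrite lee_fin weight_ge0.
  - exact: mw.
  - by apply: measurable_funeM; exact: mEF.
  - by move=> x /hx x0; rewrite -EFinM lee_fin weight_tail.
rewrite ge0_integralZl_EFin//.
- by rewrite int_tail -EFinM ltry.
- by move=> x _; rewrite lee_fin expR_ge0.
- exact: mEF.
- exact: expR_ge0.
Qed.

Let intZ (c : R) (F : R -> R) : 0 <= c -> (forall x, 0 <= F x) ->
  measurable_fun half (EFin \o F) ->
  (\int[mu]_(x in half) (c%:E * (F x)%:E) = c%:E * \int[mu]_(x in half) (F x)%:E)%E.
Proof.
by move=> c0 F0 mF; rewrite ge0_integralZl_EFin// => x _; rewrite lee_fin.
Qed.

Let half_recurrence : ((2 * k - 1)%:E * \int[mu]_(x in half) (weight k x)%:E =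
  (2 * k)%:E * \int[mu]_(x in half) (weight (k + 1) x)%:E)%E.
Proof.
have k20 : 0 <= 2 * k by move: hk; lra.
(* The identity defining [D] is rearranged so that all terms are nonnegative and each integral
   splits. *)
have : (\int[mu]_(x in half) ((D x)%:E + (2 * k - 1)%:E * (weight k x)%:E) =
  \int[mu]_(x in half) ((2 * k)%:E * (weight (k + 1) x)%:E + (c2 * (2 * k - 1))%:E * (tail x)%:E))%E.
  by apply: eq_integral => x _; rewrite -!EFinM -!EFinD; congr EFin; rewrite /D; ring.
have tailge0 x : 0 <= tail x by exact: expR_ge0.
have tail0 x : half x -> (0 <= (tail x)%:E)%E by rewrite lee_fin expR_ge0.
have w0 l x : half x -> (0 <= (weight l x)%:E)%E by rewrite lee_fin weight_ge0.
rewrite ge0_integralD//; first last.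
- by apply: measurable_funeM; exact: mw.
- by move=> x hx'; rewrite mule_ge0 ?w0// lee_fin ltW.
- exact: mEF.
- by move=> x /hx /D_ge0; rewrite lee_fin.
rewrite ge0_integralD//; first last.
- by apply: measurable_funeM; exact: mEF.
- by move=> x hx'; rewrite mule_ge0 ?tail0// lee_fin mulr_ge0// ?expR_ge0// ltW.
- by apply: measurable_funeM; exact: mw.
- by move=> x hx'; rewrite mule_ge0 ?w0.
rewrite (intZ (ltW k1) (weight_ge0 k) (mw k)) (intZ k20 (weight_ge0 _) (mw (k + 1))).
rewrite (intZ _ tailge0 (mEF tail_continuous)); last by rewrite mulr_ge0 ?expR_ge0// ltW.
(* The integral of [D] and that of the added [tail] term both equal [c2] and cancel. *)
rewrite int_D int_tail -EFinM mulfK ?gt_eqF// addeC.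
by move=> /(congr1 (fun z => z - c2%:E)%E); rewrite !addeK.
Qed.

Let intT l : (\int[mu]_x (weight l x)%:E = 2%:E * \int[mu]_(x in half) (weight l x)%:E)%E.
Proof.
rewrite ge0_symfun_integralT.
- by rewrite /half set_itvcy.
- exact: weight_ge0.
- exact: weight_continuous.
- by move=> x /=; rewrite weightN.
Qed.

Lemma weight_integral_lty : (\int[mu]_x (weight k x)%:E < +oo)%E.
Proof. by rewrite intT lte_mul_pinfty. Qed.

(** Integration by parts for [x * weight k x], which vanishes at infinity since [k > 1/2]. It yields
    every moment used below as a rational function of [m]. *)
Lemma weight_integral_recurrence : ((2 * k - 1)%:E * \int[mu]_x (weight k x)%:E =
  (2 * k)%:E * \int[mu]_x (weight (k + 1) x)%:E)%E.
Proof. by rewrite !intT muleCA half_recurrence muleCA. Qed.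

End Moments.

End Weight.

(** * Moments of the density *)

Section Density.
Variables (R : realType) (m : R).
Hypothesis hm : 1 / 2 < m.
Implicit Types x : R.
Let mu := @lebesgue_measure R.

Notation f := (pvii_density m).
Let c := pvii_const m.
Let I := fine (\int[mu]_x (weight m x)%:E).

Let IE : (\int[mu]_x (weight m x)%:E = I%:E)%E.
Proof.
rewrite fineK// ge0_fin_numE; first exact: weight_integral_lty.
by apply: integral_ge0 => x _; rewrite lee_fin weight_ge0.
Qed.

Let cE : c = I^-1.
Proof.
rewrite /c /pvii_const; congr (_^-1); congr fine.
by apply: eq_integral => x _; rewrite powR_weight.
Qed.

Lemma weight_le k x y : 0 <= k -> `|x| <= `|y| -> weight k y <= weight k x.
Proof.
move=> k0 xy; rewrite ler_expR !mulNr lerN2 ler_wpM2l// ler_ln ?posrE ?onesq_gt0//.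
by rewrite lerD2l -(real_normK (num_real x)) -(real_normK (num_real y)) lerXn2r// nnegrE.
Qed.

Lemma weight_lt k x y : 0 < k -> `|x| < `|y| -> weight k y < weight k x.
Proof.
move=> k0 xy; rewrite ltr_expR !mulNr ltrN2 ltr_pM2l// ltr_ln ?posrE ?onesq_gt0//.
by rewrite ltrD2l -(real_normK (num_real x)) -(real_normK (num_real y)) ltrXn2r// nnegrE.
Qed.

Let m0 : 0 < m. Proof. by move: hm; lra. Qed.

Let I_gt0 : 0 < I.
Proof.
rewrite -lte_fin -IE; apply: (@lt_le_trans _ _ (\int[mu]_(x in `[0%R, 1%R]) (weight m x)%:E)%E).
  apply: (@lt_le_trans _ _ (\int[mu]_(x in `[0%R, 1%R]) (weight m 1)%:E)%E).
    rewrite integral_cst//= lebesgue_measure_itv/= lte_fin ltr01 -EFinB subr0 mule1.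
    by rewrite lte_fin weight_gt0.
  apply: ge0_le_integral => //=.
  - by move=> x _; rewrite lee_fin weight_ge0.
  - by apply/measurable_EFinP; exact: weight_measurable.
  - move=> x; rewrite in_itv/= => /andP[x0 x1]; rewrite lee_fin.
    by apply: weight_le; [exact: ltW|rewrite !ger0_norm].
apply: ge0_subset_integral => //=.
- by apply/measurable_EFinP; exact: weight_measurable.
- by move=> x _; rewrite lee_fin weight_ge0.
Qed.

Let c_gt0 : 0 < c. Proof. by rewrite cE invr_gt0. Qed.

Lemma pvii_densityE x : f x = c * weight m x.
Proof. by rewrite /pvii_density powR_weight. Qed.

Lemma pvii_density_gt0 x : 0 < f x.
Proof. by rewrite pvii_densityE mulr_gt0 ?weight_gt0. Qed.

Lemma pvii_density_ge0 x : 0 <= f x. Proof. exact/ltW/pvii_density_gt0. Qed.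

Lemma pvii_density_measurable : measurable_fun setT f.
Proof.
rewrite (_ : f = (fun x => c * weight m x)); last exact/funext/pvii_densityE.
by apply: measurable_funM => //; exact: weight_measurable.
Qed.

Lemma pvii_density_ratio x y : f y / f x = expR (m * (rho x - rho y)).
Proof.
rewrite !pvii_densityE -mulf_div divff ?gt_eqF// mul1r /weight -expRB; congr expR; ring.
Qed.

(** Expectation under the centred density, as a relation that carries integrability along: [psi] and
    [dpsi] change sign, and linearity of the integral then requires it. *)
Definition mean (g : R -> R) (e : R) :=
  mu.-integrable setT (fun x => (g x * f x)%:E) /\
  (\int[mu]_x (g x * f x)%:E = e%:E)%E.

Lemma mean_ge0 (g : R -> R) (e : R) : measurable_fun setT g -> (forall x, 0 <= g x) ->
  (\int[mu]_x (g x * f x)%:E = e%:E)%E -> mean g e.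
Proof.
move=> mg g0 ge; split => //; apply/integrableP; split.
  by apply/measurable_EFinP; apply: measurable_funM => //; exact: pvii_density_measurable.
rewrite [ltLHS](_ : _ = e%:E) ?ltry// -ge; apply: eq_integral => x _.
by rewrite gee0_abs// lee_fin mulr_ge0// pvii_density_ge0.
Qed.

Lemma mean_lin (k : R) (g h : R -> R) (e e' : R) : mean g e -> mean h e' ->
  mean (fun x => k * g x + h x) (k * e + e').
Proof.
move=> [ig eg] [ih eh].
have E : (fun x => ((k * g x + h x) * f x)%:E) =
         (fun x => k%:E * (g x * f x)%:E + (h x * f x)%:E)%E.
  by apply/funext => x; rewrite -EFinM -EFinD; congr EFin; ring.
split; rewrite E.
  by apply: integrableD => //; exact: integrableZl.
rewrite integralD//; last exact: integrableZl.
by rewrite integralZl// eg eh -EFinM -EFinD.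
Qed.

Lemma mean_le (g h : R -> R) (e : R) : measurable_fun setT g -> (forall x, 0 <= g x) ->
  mean h e -> (forall x, g x <= h x) ->
  (\int[mu]_x (g x * f x)%:E <= e%:E)%E.
Proof.
move=> mg g0 [ih eh] gh; rewrite -eh; apply: ge0_le_integral => //=.
- by move=> x _; rewrite lee_fin mulr_ge0// pvii_density_ge0.
- by apply/measurable_EFinP; apply: measurable_funM => //; exact: pvii_density_measurable.
- exact: measurable_int ih.
- by move=> x _; rewrite lee_fin ler_wpM2r// pvii_density_ge0.
Qed.

Let int_weight (k J : R) : (\int[mu]_x (weight (m + k) x)%:E = (J * I)%:E)%E ->
  mean (weight k) J.
Proof.
move=> h; apply: mean_ge0; [exact: weight_measurable|exact: weight_ge0|].
transitivity (\int[mu]_x (c%:E * (weight (m + k) x)%:E))%E.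
  by apply: eq_integral => x _; rewrite -EFinM pvii_densityE weight_add; congr EFin; ring.
rewrite ge0_integralZl_EFin//.
- by rewrite h -EFinM cE mulrCA mulVf ?mulr1// gt_eqF.
- by move=> x _; rewrite lee_fin weight_ge0.
- by apply/measurable_EFinP; exact: weight_measurable.
- exact: ltW.
Qed.

Let weight0 x : weight 0 x = 1. Proof. by rewrite /weight oppr0 mul0r expR0. Qed.

Lemma mean_one : mean (cst 1) 1.
Proof.
rewrite (_ : cst 1 = weight 0); last by apply/funext => x; rewrite weight0.
by apply: int_weight; rewrite addr0 mul1r.
Qed.

Let rec_step (k J : R) : 1 / 2 < k -> (\int[mu]_x (weight k x)%:E = J%:E)%E ->
  (\int[mu]_x (weight (k + 1) x)%:E = ((2 * k - 1) / (2 * k) * J)%:E)%E.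
Proof.
move=> hk h; have := weight_integral_recurrence hk; rewrite h.
have fin : (\int[mu]_x (weight (k + 1) x)%:E)%E \is a fin_num.
  rewrite ge0_fin_numE; first by apply: weight_integral_lty; lra.
  by apply: integral_ge0 => x _; rewrite lee_fin weight_ge0.
rewrite -(fineK fin) -!EFinM => -[] h'; congr EFin.
by rewrite mulrAC h' mulrAC mulfV ?mul1r// gt_eqF//; lra.
Qed.

Let u1 := (2 * m - 1) / (2 * m).
Let u2 := (2 * m + 1) / (2 * (m + 1)) * u1.

Let mean_w1 : mean (weight 1) u1.
Proof. exact/int_weight/rec_step. Qed.

Let mean_w2 : mean (weight 2) u2.
Proof.
apply: int_weight; rewrite (_ : m + 2 = (m + 1) + 1); last by ring.
have h := rec_step hm IE.
rewrite (@rec_step (m + 1) _ _ h); last by move: hm; lra.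
by congr EFin; rewrite /u2 /u1 -!mulrA; congr (_ * _); ring.
Qed.

Lemma psi_continuous : continuous (@psi R).
Proof.
move=> x; apply: cvgM; first exact: cvg_id.
apply: cvgV; first exact: onesq_neq0.
by apply: cvgD; [exact: cvg_cst|exact: exprn_continuous].
Qed.

Lemma psi_measurable : measurable_fun setT (@psi R).
Proof. by apply: continuous_measurable_fun; exact: psi_continuous. Qed.

Lemma psiN x : psi (- x) = - psi x.
Proof. by rewrite /psi sqrrN mulNr. Qed.

Lemma pvii_densityN x : f (- x) = f x.
Proof. by rewrite !pvii_densityE weightN. Qed.

(** Oddness of [psi], applied through the nonnegative function [1 / 2 + psi]: its product with [f]
    and the reflection of that product add up to [f], so its mean is [1 / 2]. *)
Let mean_psi : mean (@psi R) 0.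
Proof.
pose g (x : R) := 1 / 2 + psi x.
have g0 x : 0 <= g x by have := psi_bound x; rewrite ler_norml /g; lra.
have mg : measurable_fun setT g by apply: measurable_funD => //; exact: psi_measurable.
have mgf : measurable_fun setT (g \* f).
  by apply: measurable_funM => //; exact: pvii_density_measurable.
have gf0 x : 0 <= (g \* f) x by rewrite mulr_ge0// pvii_density_ge0.
have mNf : measurable_fun setT (fun x => (g \* f) (- x)).
  by apply: (measurableT_comp mgf); exact: oppr_measurable.
have E : (\int[mu]_x ((g \* f) x)%:E + \int[mu]_x ((g \* f) (- x))%:E = 1)%E.
  rewrite -ge0_integralD//=.
  - rewrite -[RHS]mean_one.2; apply: eq_integral => x _; rewrite -EFinD; congr EFin.
    by rewrite /g pvii_densityN psiN/=; field.
  - by move=> x _; rewrite lee_fin; exact: gf0.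
  - exact/measurable_EFinP.
  - by move=> x _; rewrite lee_fin; exact: (gf0 (- x)).
  - exact/measurable_EFinP.
rewrite (ge0_integral_opp mgf gf0) in E.
have h : mean g (1 / 2).
  apply: mean_ge0 => //; move: E; rewrite /GRing.mul_fun/=.
  have : (0 <= \int[mu]_x (g x * f x)%:E)%E by apply: integral_ge0 => x _; rewrite lee_fin; exact: gf0.
  by case: (\int[mu]_x (g x * f x)%:E)%E => //= r _ [] ?; congr EFin; lra.
have := mean_lin (- (1 / 2)) mean_one h.
rewrite (_ : (fun x => _) = @psi R); last by apply/funext => x; rewrite /g /=; ring.
by rewrite mulr1 addNr.
Qed.

(** This is the mean of [dpsi]. The score for the location is [2 * m * psi], so the Fisher
    information is [2 * m * fisher] and the rate [m * fisher] is half of it. *)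
Definition fisher : R := (2 * m - 1) / (2 * (m + 1)).

(** Everything reduces to two moments, since [dpsi = 2 * weight 2 - weight 1] and
    [psi ^+ 2 = weight 1 - weight 2]. *)
Lemma mean_quadratic al be ga ze :
  mean (fun x => al + be * psi x + ga * dpsi x + ze * psi x ^+ 2)
       (al + ga * fisher + ze * (fisher / (2 * m))).
Proof.
have h1 := mean_lin (2 * ga - ze) mean_w2 (mean_lin (ze - ga) mean_w1
  (mean_lin be mean_psi (mean_lin (al - 1) mean_one mean_one))).
have m1 : m + 1 != 0 by rewrite gt_eqF//; move: hm; lra.
have mn0 : m != 0 by rewrite gt_eqF.
have -> : al + ga * fisher + ze * (fisher / (2 * m)) =
  (2 * ga - ze) * u2 + ((ze - ga) * u1 + (be * 0 + ((al - 1) * 1 + 1))).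
  by rewrite /fisher /u2 /u1; field; apply/andP.
rewrite (_ : (fun x => _) = (fun x => (2 * ga - ze) * weight 2 x +
  ((ze - ga) * weight 1 x + (be * psi x + ((al - 1) * cst 1 x + cst 1 x)))))//.
apply/funext => x; rewrite (_ : 2 = 1 + 1 :> R)// weight_add weight1 /psi /dpsi/=.
by field; exact: onesq_neq0.
Qed.

(* The affinity of [f] and its translate is [1 - ||sqrt f - sqrt f_tau||^2 / 2], and the
   two densities differ by a fixed amount near the origin. *)
Lemma affinity_bound (del : R) : 0 < del ->
  exists2 q : R, 0 < q & forall tau, del <= `|tau| ->
   (\int[mu]_x (expR (m / 2 * (rho x - rho (x - tau))) * f x)%:E <= (1 - q)%:E)%E.
Proof.
move=> d0; have m2 : 0 < m / 2 by move: hm; lra.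
(* If [|x| <= del / 4] then [|x - tau| >= 3 * del / 4]; on [J] the two half-power weights are
   therefore separated by [A0 - B0]. *)
pose A0 := weight (m / 2) (del / 4); pose B0 := weight (m / 2) (3 * del / 4).
pose k := c * (A0 - B0) ^+ 2 / 2; pose J := `[- (del / 4), del / 4]%classic : set R.
have AB : B0 < A0 by apply: weight_lt => //; rewrite !ger0_norm; lra.
have k0 : 0 < k by rewrite /k divr_gt0// mulr_gt0// exprn_gt0// subr_gt0.
exists (k * (del / 2)); first by rewrite mulr_gt0//; lra.
move=> tau htau; pose g x := expR (m / 2 * (rho x - rho (x - tau))) * f x.
have gE x : g x = c * (weight (m / 2) x * weight (m / 2) (x - tau)).
  by rewrite /g pvii_densityE mulrCA /weight -!expRD; congr (_ * expR _); field.
have sqw x : weight (m / 2) x ^+ 2 = weight m x.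
  by rewrite expr2 -weight_add; congr (weight _ x); field.
have fE x : f x = c * weight (m / 2) x ^+ 2 by rewrite sqw pvii_densityE.
(* This is [2ab = a^2 + b^2 - (a - b)^2], with the last square kept only on [J]. *)
have pw x : g x + k * \1_J x <= 1 / 2 * f x + 1 / 2 * f (x - tau).
  rewrite gE !fE /k; set a := weight _ x; set b := weight _ (x - tau).
  suff : (A0 - B0) ^+ 2 * \1_J x <= (a - b) ^+ 2.
    by move=> /(ler_wpM2l (ltW c_gt0)); lra.
  rewrite indicE; case: (boolP (x \in J)) => [|_]; last by rewrite mulr0 sqr_ge0.
  rewrite inE /J /= in_itv/= mulr1 => /andP[x1 x2].
  have xn : `|x| <= del / 4 by rewrite ler_norml x1.
  have ha : A0 <= a.
    by apply: weight_le; [exact: ltW|rewrite (ger0_norm (_ : 0 <= del / 4))//; lra].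
  have hb : b <= B0.
    apply: weight_le; [exact: ltW|rewrite (ger0_norm (_ : 0 <= 3 * del / 4))//; last lra].
    by have := lerB_normD tau (- x); rewrite normrN (distrC tau x); lra.
  by rewrite lerXn2r ?nnegrE//; lra.
have mgT : measurable_fun setT g.
  rewrite (_ : g = fun x => c * (weight (m / 2) x * weight (m / 2) (x - tau))); last exact/funext.
  apply: measurable_funM => //; apply: measurable_funM; first exact: weight_measurable.
  by apply: (measurableT_comp (@weight_measurable R (m / 2) setT)); exact: measurable_funB.
have g0 x : 0 <= g x by rewrite gE !mulr_ge0 ?weight_ge0// ltW.
have mft : measurable_fun setT (fun x => f (x - tau)).
  by apply: (measurableT_comp pvii_density_measurable); exact: measurable_funB.
have i1 : (\int[mu]_x (f x)%:E = 1)%E.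
  by rewrite -mean_one.2; apply: eq_integral => x _; rewrite /= mul1r.
have i2 : (\int[mu]_x (f (x - tau))%:E = 1)%E.
  by rewrite (@ge0_integral_shift _ _ f)//; [exact: pvii_density_measurable|exact: pvii_density_ge0].
have mJ : measurable J by exact: measurable_itv.
have I1 : (\int[mu]_x (g x)%:E + (k * (del / 2))%:E <= 1)%E.
  have -> : (k * (del / 2))%:E = (\int[mu]_x (k%:E * (\1_J x)%:E))%E.
    rewrite ge0_integralZl_EFin ?(ltW k0)//; last first.
      exact/measurable_EFinP.
    rewrite integral_indic// setIT.
    have muJ : mu J = (del / 2)%:E.
      rewrite /mu /J lebesgue_measure_itv/= lte_fin.
      rewrite (_ : - (del / 4) < del / 4); last lra.
      by rewrite -EFinB; congr EFin; field.
    by rewrite EFinM -muJ.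
  rewrite -ge0_integralD//; first last.
  - by apply: measurable_funeM; exact/measurable_EFinP.
  - by move=> x _; rewrite mule_ge0// lee_fin// ltW.
  - exact/measurable_EFinP.
  - by move=> x _; rewrite lee_fin.
  apply: (@le_trans _ _ (\int[mu]_x ((1 / 2)%:E * (f x)%:E + (1 / 2)%:E * (f (x - tau))%:E))%E).
    apply: ge0_le_integral => //=.
    - by move=> x _; rewrite adde_ge0 ?mule_ge0 ?lee_fin// ltW.
    - apply: emeasurable_funD; first exact/measurable_EFinP.
      by apply: measurable_funeM; exact/measurable_EFinP.
    - apply: emeasurable_funD; apply: measurable_funeM; apply/measurable_EFinP => //.
      exact: pvii_density_measurable.
    - by move=> x _; rewrite -!EFinM -!EFinD lee_fin.
  have h2 : 0 <= 1 / 2 :> R by lra.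
  rewrite ge0_integralD//; first last.
  - by apply: measurable_funeM; exact/measurable_EFinP.
  - by move=> x _; rewrite mule_ge0// lee_fin pvii_density_ge0.
  - by apply: measurable_funeM; apply/measurable_EFinP; exact: pvii_density_measurable.
  - by move=> x _; rewrite mule_ge0// lee_fin pvii_density_ge0.
  rewrite ge0_integralZl_EFin//; first last.
  - by apply/measurable_EFinP; exact: pvii_density_measurable.
  - by move=> x _; rewrite lee_fin pvii_density_ge0.
  rewrite ge0_integralZl_EFin//; first last.
  - exact/measurable_EFinP.
  - by move=> x _; rewrite lee_fin pvii_density_ge0.
  by rewrite i1 i2 !mule1 -EFinD lee_fin; lra.
by rewrite EFinB leeBrDr.
Qed.

Lemma power_moment : exists lam M : R, 0 < lam /\
  (\int[mu]_x (expR (2 * lam * rho x) * f x)%:E = M%:E)%E.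
Proof.
(* With this choice the remaining exponent [m - 2 * lam = m / 2 + 1 / 4] still exceeds [1 / 2]. *)
pose lam := (m - 1 / 2) / 4.
have l0 : 0 < lam by rewrite /lam; move: hm; lra.
exists lam, (c * fine (\int[mu]_x (weight (m - 2 * lam) x)%:E)%E); split => //.
transitivity (\int[mu]_x (c%:E * (weight (m - 2 * lam) x)%:E))%E.
  apply: eq_integral => x _; rewrite -EFinM pvii_densityE; congr EFin.
  by rewrite /weight mulrCA -expRD; congr (_ * expR _); ring.
rewrite ge0_integralZl_EFin//; last 3 first.
- by move=> x _; rewrite lee_fin weight_ge0.
- by apply/measurable_EFinP; exact: weight_measurable.
- exact: ltW.
rewrite EFinM fineK// ge0_fin_numE.
  by apply: weight_integral_lty; rewrite /lam; move: hm; lra.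
by apply: integral_ge0 => x _; rewrite lee_fin weight_ge0.
Qed.

End Density.

(** * Expectations of products *)

Section WeightedIntegral.
Local Open Scope ereal_scope.
Context d (T : measurableType d) (R : realType).
Variables (m : {measure set T -> \bar R}) (D : set T) (mD : measurable D).
Variables (V Y : T -> R).
Hypotheses (mV : measurable_fun setT V) (V0 : forall w, (0 <= V w)%R).
Hypothesis mY : measurable_fun setT Y.

Import HBNNSimple.

Let weighted_indic (B : set R) : measurable B ->
  \int[m]_(w in D) (\1_B (Y w) * V w)%:E =
  \int[m]_(w in D `&` Y @^-1` B) (V w)%:E.
Proof.
move=> mB; rewrite integral_mkcondr; apply: eq_integral => w _.
rewrite patchE indicE; case: (boolP (w \in Y @^-1` B)).
  by rewrite inE/= => wB; rewrite mem_set// mul1r.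
by rewrite notin_setE/= => wB; rewrite memNset// mul0r.
Qed.

(** The right-hand side depends only on the weighted law of [Y], so two settings with the same
    weighted law give the same integral for simple functions. *)
Lemma weighted_nnsfun (h : {nnsfun R >-> R}) :
  \int[m]_(w in D) (h (Y w) * V w)%:E =
  \sum_(r \in range h) r%:E * \int[m]_(w in D `&` Y @^-1` (h @^-1` [set r])) (V w)%:E.
Proof.
have mterm (r : R) : measurable_fun D (fun w => (\1_(h @^-1` [set r]) (Y w) * V w)%R).
  apply: measurable_funTS; apply: measurable_funM => //.
  have mi : measurable_fun setT (\1_(h @^-1` [set r]) : R -> R) by [].
  exact: (measurableT_comp mi mY).
transitivity (\int[m]_(w in D)
    \sum_(r \in range h) (r%:E * (\1_(h @^-1` [set r]) (Y w) * V w)%:E)).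
  apply: eq_integral => w _; rewrite EFinM fimfunE -fsumEFin// ge0_mule_fsuml.
    by apply: eq_fsbigr => r _; rewrite !EFinM muleA.
  by move=> r; rewrite EFinM nnfun_muleindic_ge0.
rewrite ge0_integral_fsum//.
- apply: eq_fsbigr => r; rewrite inE => -[y _ <-].
  rewrite ge0_integralZl_EFin//.
  + by rewrite weighted_indic.
  + by move=> w _; rewrite lee_fin mulr_ge0.
  + exact/measurable_EFinP.
- by move=> r; apply: measurable_funeM; exact/measurable_EFinP.
- by move=> r w _; rewrite EFinM muleA mule_ge0 ?nnfun_muleindic_ge0// lee_fin.
Qed.

(** Monotone convergence carries the agreement from simple functions to all nonnegative measurable
    ones. *)
Lemma weighted_lim (g : R -> R) (mg : measurable_fun setT (EFin \o g)) :
  (forall x, (0 <= g x)%R) ->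
  \int[m]_(w in D) (g (Y w) * V w)%:E =
  limn (fun n => \int[m]_(w in D) (nnsfun_approx measurableT mg n (Y w) * V w)%:E).
Proof.
move=> g0; rewrite -monotone_convergence//=.
- apply: eq_integral => w _; apply/esym/cvg_lim => //=.
  rewrite EFinM; under eq_fun do rewrite EFinM.
  apply: cvgeZr => //; apply: cvg_nnsfun_approx => //.
  by move=> x _; rewrite lee_fin.
- move=> n; apply/measurable_EFinP; apply: measurable_funTS.
  apply: measurable_funM => //.
  have mi : measurable_fun setT (nnsfun_approx measurableT mg n : R -> R) by [].
  exact: (measurableT_comp mi mY).
- by move=> n w _; rewrite lee_fin mulr_ge0.
- move=> w _ a b ab; rewrite lee_fin ler_wpM2r//.
  exact/lefP/nd_nnsfun_approx.
Qed.

End WeightedIntegral.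

Section WeightedDensity.
Import HBNNSimple.

(* A weighted law of [Y] that agrees with a density on sets agrees with it on
   nonnegative measurable functions. *)
Lemma weighted_density d (T : measurableType d) (R : realType)
    (m : {measure set T -> \bar R}) (D : set T) (V Y : T -> R) (p : R -> R) :
  measurable D -> measurable_fun setT V -> (forall w, 0 <= V w) ->
  measurable_fun setT Y -> measurable_fun setT p -> (forall x, 0 <= p x) ->
  (forall B : set R, measurable B ->
     \int[m]_(w in D `&` Y @^-1` B) (V w)%:E =
     \int[@lebesgue_measure R]_(x in B) (p x)%:E)%E ->
  forall g : R -> R, measurable_fun setT g -> (forall x, 0 <= g x) ->
  (\int[m]_(w in D) (g (Y w) * V w)%:E =
   \int[@lebesgue_measure R]_x (g x * p x)%:E)%E.
Proof.
move=> mD mV V0 mY mp p0 eqB g mg g0.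
have mEg : measurable_fun setT (EFin \o g) by exact/measurable_EFinP.
rewrite (weighted_lim _ mD mV V0 mY mEg g0).
(* The target integral is the same construction with Lebesgue measure, weight [p] and the identity
   as variable. *)
rewrite (@weighted_lim _ _ R (@lebesgue_measure R) setT measurableT p id mp p0
  (@measurable_id _ _ _) g mEg g0).
congr (limn _); apply/funext => n; rewrite weighted_nnsfun// weighted_nnsfun//.
by apply: eq_fsbigr => r _; rewrite eqB// setTI.
Qed.

End WeightedDensity.

(** * Expectation of a product over an independent sample *)

Section Product.
Variables (R : realType) (d : measure_display) (T : measurableType d).
Variables (P : probability T R) (X : nat -> T -> R) (p : R -> R).
Hypotheses (mX : forall i, measurable_fun setT (X i)).
Hypotheses (mp : measurable_fun setT p) (p0 : forall x, 0 <= p x).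
Hypothesis indX : mutually_independent P X.
Hypothesis lawX : forall i (B : set R), measurable B ->
  P (X i @^-1` B) = (\int[@lebesgue_measure R]_(x in B) (p x)%:E)%E.

Let cap (J : seq nat) (B : nat -> set R) := \bigcap_(i in [set i | i \in J]) (X i @^-1` B i).

Let mcap J B : (forall i, measurable (B i)) -> measurable (cap J B).
Proof.
move=> mB; apply: fin_bigcap_measurable; first exact: finite_seq.
by move=> i _; rewrite -[_ @^-1` _]setTI; exact: mX.
Qed.

Let prodX (g : R -> R) k w := \prod_(i < k) g (X i w).

Let mprodX (g : R -> R) k : measurable_fun setT g -> measurable_fun setT (prodX g k).
Proof.
move=> mg; apply: measurable_prod => i _.
exact: (measurableT_comp mg (mX i)).
Qed.

(** Independence is available for events only. The induction on [k] is therefore strengthened by an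
    event on coordinates of index at least [k]: conditions on [X k] can enter that event before
    [X k] is integrated out. *)
Let partial_product (g : R -> R) (q : R) k :
  measurable_fun setT g -> (forall x, 0 <= g x) ->
  (\int[@lebesgue_measure R]_x (g x * p x)%:E = q%:E)%E ->
  forall J B, uniq J -> (forall i, measurable (B i)) -> all (leq k) J ->
  (\int[P]_(w in cap J B) (prodX g k w)%:E = (q ^+ k)%:E * P (cap J B))%E.
Proof.
move=> mg g0 gq; have prod0 j w : 0 <= prodX g j w by exact: prodr_ge0.
have q0 : 0 <= q.
  rewrite -lee_fin -gq; apply: integral_ge0 => x _.
  by rewrite lee_fin mulr_ge0.
elim: k => [|k IH] J B uJ mB kJ.
  rewrite expr0 mul1e; under eq_integral do rewrite /prodX big_ord0.
  by rewrite integral_cst ?mul1e//; exact: mcap.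
have kNJ : k \notin J by apply/negP => /(allP kJ); rewrite ltnn.
pose c := fine (P (cap J B)).
have cE : P (cap J B) = c%:E by rewrite fineK// fin_num_measure//; exact: mcap.
have c0 : 0 <= c by rewrite fine_ge0.
have kJ' : all (leq k) (k :: J).
  by rewrite /= leqnn/=; apply: sub_all kJ => i; exact: ltnW.
have uJ' : uniq (k :: J) by rewrite /= kNJ.
transitivity (\int[P]_(w in cap J B) (g (X k w) * prodX g k w)%:E)%E.
  by apply: eq_integral => w _; rewrite /prodX big_ord_recr/= mulrC.
(* On the event, and weighted by the first [k] factors, [X k] has density [q ^+ k * c * p]; the
   induction hypothesis for [k :: J] provides this. *)
rewrite (@weighted_density _ _ _ P (cap J B) (prodX g k) (X k) (fun x => q ^+ k * c * p x))//.
- transitivity (\int[@lebesgue_measure R]_x ((q ^+ k * c)%:E * (g x * p x)%:E))%E.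
    by apply: eq_integral => x _; rewrite -EFinM; congr EFin; ring.
  rewrite ge0_integralZl_EFin//.
  + by rewrite gq cE -!EFinM; congr EFin; rewrite exprSr; ring.
  + by move=> x _; rewrite lee_fin mulr_ge0.
  + by apply/measurable_EFinP; exact: measurable_funM.
  + by rewrite mulr_ge0// exprn_ge0.
- exact: mcap.
- exact: mprodX.
- exact: measurable_funM.
- by move=> x; rewrite !mulr_ge0// exprn_ge0.
(* The [k]-th set of [B] may be overwritten by [C] because [k] is not in [J]. *)
- move=> C mC; pose B' i := if i == k then C else B i.
  have mB' i : measurable (B' i) by rewrite /B'; case: ifP.
  have capE : cap J B `&` X k @^-1` C = cap (k :: J) B'.
    apply/seteqP; split => w.
      move=> [wJ wC] i; rewrite /= inE /B' => /predU1P[->|iJ]; first by rewrite eqxx.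
      by case: ifP => [/eqP ->//|_]; exact: wJ.
    move=> wJ; split.
      move=> i /= iJ; have := wJ i; rewrite /= inE iJ orbT /B' => /(_ isT).
      by case: ifP => // /eqP ik; move: kNJ; rewrite -ik iJ.
    by have := wJ k; rewrite /= mem_head /B' eqxx => /(_ isT).
  rewrite capE IH// -capE.
  have -> : P (cap J B `&` X k @^-1` C) = (c%:E * P (X k @^-1` C))%E.
    rewrite capE /cap indX// big_cons {1}/B' eqxx muleC; congr (_ * _)%E.
    rewrite -cE /cap indX//; apply: eq_big_seq => i iJ.
    by rewrite /B'; case: ifP => // /eqP ik; move: kNJ; rewrite -ik iJ.
  rewrite lawX// muleA -EFinM -ge0_integralZl_EFin//.
  + by move=> x _; rewrite lee_fin.
  + by apply: measurable_funTS; exact/measurable_EFinP.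
  + by rewrite mulr_ge0// exprn_ge0.
Qed.

Lemma product_formula (g : R -> R) (q : R) n :
  measurable_fun setT g -> (forall x, 0 <= g x) ->
  (\int[@lebesgue_measure R]_x (g x * p x)%:E = q%:E)%E ->
  (\int[P]_w (\prod_(i < n) g (X i w))%:E = (q ^+ n)%:E)%E.
Proof.
move=> mg g0 gq; have := @partial_product g q n mg g0 gq [::] (fun=> setT) isT.
have -> : cap [::] (fun=> setT) = setT by apply/seteqP; split => // w _ i.
by rewrite probability_setT mule1; apply.
Qed.

End Product.

(** * Exponential tilts *)

Section Cover.
Variables (R : realType) (m : R).
Hypothesis hm : 1 / 2 < m.
Let mu := @lebesgue_measure R.
Notation f := (pvii_density m).
Let a := fisher m.

(** A nonnegative factor with mean at most [q] at the true centre. By independence its product over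
    [n] observations has expectation at most [q ^+ n], as Markov's inequality requires. *)
Definition tilt (g : R -> R) (q : R) : Prop :=
  [/\ measurable_fun setT g, forall x, 0 <= g x &
      (\int[mu]_x (g x * f x)%:E <= q%:E)%E].

Let m0 : 0 < m. Proof. by move: hm; lra. Qed.

Lemma fisher_gt0 : 0 < a.
Proof. by rewrite /a /fisher divr_gt0//; move: hm; lra. Qed.

Lemma fisher_lt1 : a < 1.
Proof. by rewrite /a /fisher ltr_pdivrMr; move: hm; lra. Qed.

Lemma tilt_ge0 (g : R -> R) (q : R) : tilt g q -> 0 <= q.
Proof.
move=> [_ g0 gq]; rewrite -lee_fin; apply: le_trans gq.
by apply: integral_ge0 => x _; rewrite lee_fin mulr_ge0 ?pvii_density_ge0.
Qed.

Lemma tilt_le (g : R -> R) (q q' : R) : q <= q' -> tilt g q -> tilt g q'.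
Proof. by move=> qq' [mg g0 gq]; split => //; apply: le_trans gq _; rewrite lee_fin. Qed.

(** Fills the places of the covering family that correspond to grid points too close to the
    origin. *)
Lemma tilt0 (q : R) : 0 <= q -> tilt (cst 0) q.
Proof.
by move=> q0; split => //; under eq_integral do rewrite mul0r; rewrite integral0 lee_fin.
Qed.

(** The local tilts are bounded pointwise by such expressions, whose means are known exactly. *)
Lemma tilt_quadratic (g : R -> R) (al be ga ze : R) :
  measurable_fun setT g -> (forall x, 0 <= g x) ->
  (forall x, g x <= al + be * psi x + ga * dpsi x + ze * psi x ^+ 2) ->
  tilt g (al + ga * a + ze * (a / (2 * m))).
Proof. by move=> mg g0 le; split => //; apply: mean_le le => //; exact: mean_quadratic. Qed.

Lemma measurable_comp_expR (h : R -> R) : continuous h ->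
  measurable_fun setT (fun x => expR (h x)).
Proof.
move=> ch; apply: continuous_measurable_fun => x.
by apply: continuous_comp; [exact: ch|exact: continuous_expR].
Qed.

Lemma comp_affine_continuous (h : R -> R) (s e : R) : continuous h ->
  continuous (fun x => h (s * x + e)).
Proof.
move=> ch x; apply: (@continuous_comp _ _ _ (fun x => s * x + e) h); last exact: ch.
by apply: cvgD; [apply: cvgM; [exact: cvg_cst|exact: cvg_id]|exact: cvg_cst].
Qed.

Lemma dpsi_continuous : continuous (@dpsi R).
Proof.
move=> x; apply: cvgM.
  by apply: cvgB; [exact: cvg_cst|exact: exprn_continuous].
apply: cvgV; first by rewrite sqrf_eq0 onesq_neq0.
apply: (@continuous_comp R R R (fun x => 1 + x ^+ 2) (fun y => y ^+ 2)).
  by apply: cvgD; [exact: cvg_cst|exact: exprn_continuous].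
exact: exprn_continuous.
Qed.

(** Collects the cubic errors: [3 * m] from expanding [psi (x - e)], [5 * m ^+ 2] from replacing its
    square by [psi x ^+ 2], and [2 * m ^+ 3] from the exponential series. *)
Let C := 3 * m + 5 * m ^+ 2 + 2 * m ^+ 3.

(* The tilting parameter [2 m e] is the optimal one: the first-order mean of [psi (x - e)]
   is [- e a] and its variance [a / (2 m)]. *)
Lemma score_expansion (e x : R) : 0 < e -> e <= 1 -> m * e <= 1 / 2 ->
  expR (2 * m * e * psi (x - e)) <=
  (1 + C * e ^+ 3) + 2 * m * e * psi x + - (2 * m * e ^+ 2) * dpsi x
  + 2 * m ^+ 2 * e ^+ 2 * psi x ^+ 2.
Proof.
move=> e0 e1 me; set y := 2 * m * e * psi (x - e).
have pe := psi_bound (x - e); have px := psi_bound x; have dx := dpsi_bound x.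
have me0 : 0 < m * e by rewrite mulr_gt0.
have yb : `|y| <= m * e.
  rewrite /y normrM ger0_norm; last by rewrite -mulrA mulr_ge0// ltW.
  have : 2 * m * e * `|psi (x - e)| <= 2 * m * e * (1 / 2).
    by rewrite ler_pM2l// -mulrA mulr_gt0.
  lra.
have t := psi_taylor x (- e); rewrite sqrrN in t.
have h1 : psi (x - e) <= psi x - e * dpsi x + 3 / 2 * e ^+ 2.
  by move: t; rewrite ler_norml => /andP[_]; lra.
have h2 : psi (x - e) ^+ 2 <= psi x ^+ 2 + 5 / 2 * e.
  have d1 : `|psi (x - e) - psi x| <= 5 / 2 * e.
    have : `|e * dpsi x| <= e.
      by rewrite normrM (gtr0_norm e0) -[leRHS]mulr1 ler_pM2l.
    have : e ^+ 2 <= e by rewrite expr2 -[leRHS]mulr1 ler_pM2l.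
    by move: t; rewrite !ler_norml => /andP[? ?] ? /andP[? ?]; apply/andP; split; lra.
  have d2 : `|psi (x - e) + psi x| <= 1.
    by move: pe px; rewrite !ler_norml => /andP[? ?] /andP[? ?]; apply/andP; split; lra.
  have := ler_pM (normr_ge0 _) (normr_ge0 _) d1 d2.
  rewrite -normrM ler_norml mulr1 => /andP[_].
  rewrite (_ : (_ - _) * (_ + _) = psi (x - e) ^+ 2 - psi x ^+ 2); last by ring.
  lra.
have := expR_taylor2 (le_trans yb me); rewrite ler_norml => /andP[_].
have y3 : `|y| ^+ 3 <= (m * e) ^+ 3 by rewrite lerXn2r// nnegrE ltW.
have h1' : y <= 2 * m * e * (psi x - e * dpsi x + 3 / 2 * e ^+ 2).
  by rewrite ler_pM2l// -mulrA mulr_gt0.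
have h2' : y ^+ 2 / 2 <= 2 * (m * e) ^+ 2 * (psi x ^+ 2 + 5 / 2 * e).
  have : 2 * (m * e) ^+ 2 * psi (x - e) ^+ 2 <= 2 * (m * e) ^+ 2 * (psi x ^+ 2 + 5 / 2 * e).
    by rewrite ler_pM2l// mulr_gt0// exprn_gt0.
  by apply: le_trans; rewrite /y le_eqVlt; apply/orP; left; apply/eqP; field.
have h3' : 2 * `|y| ^+ 3 <= 2 * (m * e) ^+ 3 by rewrite ler_pM2l.
move=> h4; have {h1 h2 y3 t} := lerD h1' (lerD h2' (lerD h3' h4)).
rewrite -subr_ge0 => h5; rewrite -subr_ge0; apply: le_trans h5 _.
by rewrite le_eqVlt; apply/orP; left; apply/eqP; rewrite /C; field.
Qed.

Let psi_cont := @psi_continuous R.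

(** The sign [s] treats both sides at once, [psi] being odd and [dpsi] even. At second order the
    mean is [- 2 m a e^2 + m a e^2], from the drift and the variance of the score. *)
Lemma score_tilt_aux (s e : R) : s ^+ 2 = 1 -> 0 < e -> e <= 1 -> m * e <= 1 / 2 ->
  tilt (fun x => expR (2 * m * e * psi (s * x - e))) (1 - m * a * e ^+ 2 + C * e ^+ 3).
Proof.
move=> s2 e0 e1 me.
have -> : 1 - m * a * e ^+ 2 + C * e ^+ 3 = (1 + C * e ^+ 3) + - (2 * m * e ^+ 2) * a
    + 2 * m ^+ 2 * e ^+ 2 * (a / (2 * m)).
  by field; rewrite gt_eqF.
apply: (@tilt_quadratic _ _ (s * (2 * m * e))).
- apply: measurable_comp_expR => x; apply: cvgM; first exact: cvg_cst.
  exact: (@comp_affine_continuous _ s (- e) psi_cont).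
- by move=> x; exact: expR_ge0.
- move=> x; apply: le_trans (score_expansion (s * x) e0 e1 me) _.
  have -> : psi (s * x) = s * psi x by rewrite /psi exprMn s2 mul1r mulrA.
  have -> : dpsi (s * x) = dpsi x by rewrite /dpsi exprMn s2 mul1r.
  by rewrite exprMn s2 mul1r -!mulrA !(mulrCA s).
Qed.

(** A Chernoff factor for the event that the average curvature drops to half its mean [a]. With
    [k = a / 32] the first-order gain [k * a / 2] is twice the second-order loss [8 * k ^+ 2]. *)
Lemma curvature_tilt : exists2 k : R, 0 < k &
  tilt (fun x => expR (k * (a / 2 - dpsi x))) (1 - a ^+ 2 / 128).
Proof.
have a0 := fisher_gt0; have a1 := fisher_lt1.
exists (a / 32); first by lra.
have -> : 1 - a ^+ 2 / 128 = (1 + a / 32 * (a / 2) + 8 * (a / 32) ^+ 2) + - (a / 32) * a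
  + 0 * (a / (2 * m)) by field; rewrite gt_eqF.
apply: (@tilt_quadratic _ _ 0).
- apply: measurable_comp_expR => x; apply: cvgM; first exact: cvg_cst.
  by apply: cvgB; [exact: cvg_cst|exact: dpsi_continuous].
- by move=> x; exact: expR_ge0.
move=> x; set y := a / 32 * (a / 2 - dpsi x).
have yb : `|y| <= a / 16.
  rewrite /y normrM gtr0_norm; last by lra.
  have : a / 32 * `|a / 2 - dpsi x| <= a / 32 * 2.
    rewrite ler_pM2l; last by lra.
    by have := dpsi_bound x; rewrite !ler_norml => /andP[? ?]; apply/andP; split; lra.
  by move/le_trans; apply; lra.
have yb2 : `|y| <= 1 / 2 by apply: le_trans yb _; lra.
have := expR_taylor1 yb2; rewrite ler_norml => /andP[_].
have : `|y| ^+ 2 <= (a / 16) ^+ 2 by rewrite lerXn2r// nnegrE//; lra.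
rewrite !mul0r !addr0 /y; lra.
Qed.

(** The slack [h] pays for moving [t] to a grid point, as [rho] is 1-Lipschitz. It costs a factor at
    most [expR (q / 2)] against the affinity [1 - q], and [h <= del / 2] keeps the relevant grid
    points away from 0. *)
Lemma affinity_tilt (del : R) : 0 < del -> exists h r : R, [/\ 0 < h, h <= del / 2, r < 1 &
  forall tau, del / 2 <= `|tau| ->
  tilt (fun x => expR (m / 2 * (rho x - rho (x - tau) + h))) r].
Proof.
move=> d0; have d20 : 0 < del / 2 by lra.
have [q q0 hq] := affinity_bound hm d20.
pose h := Num.min (q / m) (del / 2).
have h0 : 0 < h by rewrite lt_min d20 divr_gt0.
have hqm : m / 2 * h <= q / 2.
  have : h <= q / m by rewrite ge_min lexx.
  by rewrite ler_pdivlMr// => ?; lra.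
exists h, (expR (- (q / 2))); split => //.
- by rewrite ge_min lexx orbT.
- by rewrite expR_lt1; lra.
move=> tau htau; split.
- apply: measurable_comp_expR => x; apply: cvgM; first exact: cvg_cst.
  apply: cvgD; last exact: cvg_cst.
  apply: cvgB; first exact: rho_continuous.
  have := @comp_affine_continuous _ 1 (- tau) (@rho_continuous R) x.
  by under [X in continuous_at _ X -> _]eq_fun do rewrite mul1r.
- by move=> x; exact: expR_ge0.
have /= hq' := hq tau htau.
rewrite (_ : (fun x => _) = fun x => ((expR (m / 2 * h))%:E *
   (expR (m / 2 * (rho x - rho (x - tau))) * f x)%:E)%E); last first.
  apply/funext => x; rewrite -EFinM; congr EFin.
  by rewrite mulrDr expRD; ring.
rewrite ge0_integralZl_EFin ?expR_ge0//; last 2 first.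
- by move=> x _; rewrite lee_fin mulr_ge0 ?expR_ge0 ?pvii_density_ge0.
- apply/measurable_EFinP; apply: measurable_funM; last exact: pvii_density_measurable.
  apply: measurable_comp_expR => x; apply: cvgM; first exact: cvg_cst.
  apply: cvgB; first exact: rho_continuous.
  have := @comp_affine_continuous _ 1 (- tau) (@rho_continuous R) x.
  by under [X in continuous_at _ X -> _]eq_fun do rewrite mul1r.
apply: (@le_trans _ _ ((expR (m / 2 * h))%:E * (1 - q)%:E)%E).
  by apply: lee_wpmul2l => //; rewrite lee_fin expR_ge0.
rewrite -EFinM lee_fin (le_trans (ler_wpM2l (expR_ge0 _) (expR_ge1Dx (- q))))//.
by rewrite -expRD ler_expR; lra.
Qed.

(** Only a small power of [1 + x^2] is integrable, but choosing [K] large makes the mean of the tilt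
    as small as desired. *)
Lemma far_tilt : exists K lam : R, [/\ 0 < K, 0 < lam &
  tilt (fun x => expR (lam * (ln 2 + 2 * rho x - rho K))) (1 / 2)].
Proof.
have [lam [M [l0 hM]]] := power_moment hm.
have M0 : 0 <= M.
  rewrite -lee_fin -hM; apply: integral_ge0 => x _.
  by rewrite lee_fin mulr_ge0 ?expR_ge0 ?pvii_density_ge0.
have ln20 : 0 <= ln 2 :> R by rewrite ln_ge0//; lra.
(* Chosen so that the constant factor is at most [1 / (2 * M + 2)], against the moment [M]. *)
pose y := ln 2 + ln (2 * M + 2) / lam.
have y0 : 0 <= y by rewrite addr_ge0// divr_ge0 ?ln_ge0 ?ltW//; lra.
exists (expR y), lam; split => //; first exact: expR_gt0.
have rK : y <= rho (expR y).
  rewrite -{1}(expRK y) /rho ler_ln ?posrE ?expR_gt0 ?onesq_gt0//.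
  by have := sqr_ge0 (expR y - 1); have := expR_gt0 y; set z := expR y; nra.
split.
- apply: measurable_comp_expR => x; apply: cvgM; first exact: cvg_cst.
  apply: cvgB; last exact: cvg_cst.
  apply: cvgD; first exact: cvg_cst.
  by apply: cvgM; [exact: cvg_cst|exact: rho_continuous].
- by move=> x; exact: expR_ge0.
rewrite (_ : (fun x => _) = fun x => ((expR (lam * (ln 2 - rho (expR y))))%:E *
   (expR (2 * lam * rho x) * f x)%:E)%E); last first.
  apply/funext => x; rewrite -EFinM; congr EFin; rewrite [RHS]mulrA -expRD.
  by congr (expR _ * _); ring.
rewrite ge0_integralZl_EFin ?expR_ge0//; last 2 first.
- by move=> x _; rewrite lee_fin mulr_ge0 ?expR_ge0 ?pvii_density_ge0.
- apply/measurable_EFinP; apply: measurable_funM; last exact: pvii_density_measurable.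
  by apply: measurable_comp_expR => x; apply: cvgM; [exact: cvg_cst|exact: rho_continuous].
rewrite hM -EFinM lee_fin.
have : expR (lam * (ln 2 - rho (expR y))) <= (2 * M + 2)^-1.
  rewrite -[leRHS]lnK ?posrE ?invr_gt0; last by lra.
  rewrite ler_expR lnV ?posrE; last by lra.
  have : lam * (ln 2 - rho (expR y)) <= lam * (ln 2 - y) by rewrite ler_pM2l//; lra.
  move/le_trans; apply; rewrite /y opprD addNKr mulrN mulrCA mulfV ?mulr1// gt_eqF//.
move/(ler_wpM2r M0)/le_trans; apply.
by rewrite mulrC ler_pdivrMr; lra.
Qed.

End Cover.

(** * Covering the deviation event of the estimator by tilts *)

Section MleCover.
Variables (R : realType) (m : R).
Hypothesis hm : 1 / 2 < m.
Let a := fisher m.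
Let m0 : 0 < m. Proof. by move: hm; lra. Qed.

Lemma mle_rho n (x : 'I_n -> R) (t s : R) : is_mle m x t ->
  \sum_(i < n) rho (x i - t) <= \sum_(i < n) rho (x i - s).
Proof.
move=> /(_ s).
have c0 : 0 < pvii_const m.
  by have := pvii_density_gt0 hm 0; rewrite pvii_densityE pmulr_lgt0 ?weight_gt0.
have pE u : \prod_(i < n) pvii_density m (x i - u) =
    pvii_const m ^+ n * expR (- m * \sum_(i < n) rho (x i - u)).
  under eq_bigr do rewrite pvii_densityE.
  by rewrite big_split/= prodr_const card_ord mulr_sumr expR_sum.
rewrite !pE ler_pM2l ?exprn_gt0// ler_expR !mulNr lerN2 ler_pM2l//.
Qed.

Lemma prod_expR_ge1 n (k : R) (u : 'I_n -> R) : 0 <= k -> 0 <= \sum_(i < n) u i ->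
  1 <= \prod_(i < n) expR (k * u i).
Proof.
move=> k0 u0; rewrite -expR_sum -mulr_sumr -expR0 ler_expR.
exact: mulr_ge0.
Qed.

(** Expand [rho] at [y i - e] with step [h = t - e]. Moving the curvature to [y i] costs [3 * e],
    the cubic remainder [3 * h], together at most [a / 2] because [t <= a / 6]. If the curvature sum
    is normal, minimality at [t] forces a nonnegative score. *)
Lemma local_score n (y : 'I_n -> R) (e t : R) : 0 < e -> e < t -> t <= a / 6 ->
  \sum_(i < n) rho (y i - t) <= \sum_(i < n) rho (y i - e) ->
  0 <= \sum_(i < n) psi (y i - e) \/ 0 <= \sum_(i < n) (a / 2 - dpsi (y i)).
Proof.
move=> e0 et ta hrho; case: (leP 0 (\sum_(i < n) (a / 2 - dpsi (y i)))) => [|neg]; first by right.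
left; pose h := t - e; have h0 : 0 < h by rewrite subr_gt0.
have pw i : rho (y i - e) - 2 * h * psi (y i - e) - h ^+ 2 * (a / 2 - dpsi (y i)) <= rho (y i - t).
  have := rho_taylor (y i - e) (- h); rewrite (_ : y i - e + - h = y i - t); last by rewrite /h; ring.
  rewrite normrN (gtr0_norm h0) sqrrN ler_norml => /andP[h1 _].
  have := dpsi_lipschitz (y i) (- e); rewrite normrN (gtr0_norm e0) ler_norml => /andP[h2 _].
  have h3 : h ^+ 2 * (dpsi (y i) - 3 * e) <= h ^+ 2 * dpsi (y i - e).
    by rewrite ler_pM2l ?exprn_gt0//; lra.
  have h4 : h ^+ 2 * (3 * e + 3 * h) <= h ^+ 2 * (a / 2).
    by rewrite ler_pM2l ?exprn_gt0// /h; lra.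
  rewrite exprS in h1; nra.
have := le_trans (ler_sum _ (fun i _ => pw i)) hrho.
rewrite !sumrB -!mulr_sumr => h1.
have h2 : 0 < h ^+ 2 * - \sum_(i < n) (a / 2 - dpsi (y i)).
  by rewrite mulr_gt0 ?exprn_gt0// oppr_gt0.
have : 0 <= h * \sum_(i < n) psi (y i - e) by lra.
by rewrite pmulr_rge0.
Qed.

Lemma sum_ge1 N (s : nat -> R) j : (j < N)%N -> (forall j, 0 <= s j) -> 1 <= s j ->
  1 <= \sum_(j < N) s j.
Proof.
move=> jN s0 s1; rewrite (bigD1 (Ordinal jN))//= (le_trans s1)// lerDl.
exact: sumr_ge0.
Qed.

(** Members 0 and 1 treat the score on either side, 2 the curvature, 3 errors beyond [K], and the
    others a grid on [[-K, K]]. Only the first two have a mean bound depending on [e]; [N] and [r]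
    do not. *)
Lemma mle_cover : exists (del C : R) (N : nat) (r : R),
  [/\ 0 < del, 0 <= r, r < 1 &
   forall e : R, 0 < e -> e <= del -> exists G : nat -> R -> R,
   [/\ tilt m (G 0%N) (1 - m * a * e ^+ 2 + C * e ^+ 3),
       tilt m (G 1%N) (1 - m * a * e ^+ 2 + C * e ^+ 3),
       forall j, tilt m (G j.+2) r &
       forall n (x : 'I_n -> R) (t : R), is_mle m x t -> e < `|t| ->
         1 <= \sum_(j < N.+2) \prod_(i < n) G j (x i)]].
Proof.
have a0 := fisher_gt0 hm; rewrite -/a in a0.
(* The bounds [1] and [1 / (2 * m)] serve the expansion of the score tilt, and [a / 6] serves
   [local_score]. *)
pose del := Num.min 1 (Num.min (1 / (2 * m)) (a / 6)).
have del0 : 0 < del.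
  by rewrite !lt_min ltr01/= divr_gt0//=; [rewrite divr_gt0|rewrite mulr_gt0].
have [k k0 hk] := curvature_tilt hm.
have [h [r1 [h0 hd r11 hr1]]] := affinity_tilt hm del0.
have [K [lam [K0 lam0 hfar]]] := far_tilt hm.
pose r := Num.max r1 (Num.max (1 - a ^+ 2 / 128) (1 / 2)).
have r0 : 0 <= r by rewrite !le_max; apply/orP; right; apply/orP; right; lra.
pose tau j := - K + j%:R * h.
pose Ng := (Num.truncn (2 * K / h)).+1.
exists del, (3 * m + 5 * m ^+ 2 + 2 * m ^+ 3), Ng.+2, r; split => //.
  rewrite !gt_max r11/=; apply/andP; split; last lra.
  by rewrite ltrBlDr ltrDl divr_gt0// exprn_gt0.
move=> e e0 edel.
have e1 : e <= 1 by apply: le_trans edel _; rewrite ge_min lexx.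
have em : m * e <= 1 / 2.
  have : e <= 1 / (2 * m) by apply: le_trans edel _; rewrite !ge_min lexx orbT.
  by rewrite ler_pdivlMr ?mulr_gt0//; lra.
have ea : del <= a / 6 by rewrite !ge_min lexx !orbT.
pose G (j : nat) : R -> R := match j with
  | 0%N => fun x => expR (2 * m * e * psi (1 * x - e))
  | 1%N => fun x => expR (2 * m * e * psi (-1 * x - e))
  | 2%N => fun x => expR (k * (a / 2 - dpsi x))
  | 3%N => fun x => expR (lam * (ln 2 + 2 * rho x - rho K))
  | j.+4 => if del / 2 <= `|tau j| then
              fun x => expR (m / 2 * (rho x - rho (x - tau j) + h))
            else cst 0
  end.
have tG j : tilt m (G j.+2) r.
  case: j => [|[|j]]; rewrite /G.
  - by apply: tilt_le hk; rewrite !le_max lexx orbT.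
  - by apply: tilt_le hfar; rewrite !le_max lexx !orbT.
  - case: ifP => [ht|_]; last exact: tilt0.
    by apply: tilt_le (hr1 _ ht); rewrite le_max lexx.
exists G; split => //.
- by apply: score_tilt_aux => //; rewrite expr1n.
- by apply: score_tilt_aux => //; rewrite sqrrN expr1n.
move=> n x t tmle et.
have G0 j y : 0 <= G j y.
  case: j => [|[|j]]; [exact: expR_ge0|exact: expR_ge0|].
  by have [_] := tG j.
have mR := @mle_rho n x t ^~ tmle.
pose S j := \prod_(i < n) G j (x i).
have S0 j : 0 <= S j by exact: prodr_ge0.
have pick j : (j < Ng.+4)%N -> 1 <= S j -> 1 <= \sum_(j < Ng.+4) S j.
  by move=> jN; exact: (@sum_ge1 _ S).
have me0 : 0 <= 2 * m * e by rewrite -mulrA mulr_ge0// mulr_ge0// ltW.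
have [tdel|tdel] := leP `|t| del.
  have [tp|tn] := leP 0 t.
    rewrite ger0_norm// in et tdel.
    have [hs|hs] := local_score e0 et (le_trans tdel ea) (mR e).
      apply: (pick 0%N) => //; apply: prod_expR_ge1 => //.
      by under eq_bigr do rewrite mul1r.
    by apply: (pick 2%N) => //; apply: prod_expR_ge1 => //; exact: ltW.
  rewrite ltr0_norm// in et tdel.
  (* A negative error becomes a positive one by reflecting the sample, [rho] being even. *)
  have hr : \sum_(i < n) rho (- x i - - t) <= \sum_(i < n) rho (- x i - e).
    have := mR (- e).
    under eq_bigr do rewrite -rhoN opprB addrC.
    under [X in _ <= X]eq_bigr do rewrite -rhoN opprB addrC.
    by under [X in _ -> X <= _]eq_bigr do rewrite opprK.
  have [hs|hs] := @local_score n (fun i => - x i) _ _ e0 et (le_trans tdel ea) hr.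
    apply: (pick 1%N) => //; apply: prod_expR_ge1 => //.
    by under eq_bigr do rewrite mulN1r.
  apply: (pick 2%N) => //; apply: prod_expR_ge1; first exact: ltW.
  by under eq_bigr do rewrite /dpsi -sqrrN -/(dpsi _).
have m0t : \sum_(i < n) rho (x i - t) <= \sum_(i < n) rho (x i).
  by have := mR 0; under [X in _ <= X]eq_bigr do rewrite subr0.
have [tK|tK] := leP `|t| K; last first.
  apply: (pick 3%N) => //; apply: prod_expR_ge1; first exact: ltW.
  (* Peetre's inequality at [t], combined with [K < |t|]. *)
  have peetre i : rho (x i) - rho (x i - t) <= ln 2 + 2 * rho (x i) - rho K.
    suff : rho K <= ln 2 + rho (x i) + rho (x i - t) by lra.
    rewrite /rho -!lnM ?posrE ?mulr_gt0 ?onesq_gt0// ler_ln ?posrE ?mulr_gt0 ?onesq_gt0//.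
    have : K ^+ 2 <= t ^+ 2.
      by rewrite -(real_normK (num_real t)) lerXn2r ?nnegrE ?(ltW tK)// ltW.
    set u := x i; set v := u - t; have -> : t = u - v by rewrite /v; ring.
    have := sqr_ge0 (u + v); have := mulr_ge0 (sqr_ge0 u) (sqr_ge0 v); nra.
  apply: le_trans (ler_sum _ (fun i _ => peetre i)).
  by rewrite sumrB subr_ge0.
(* The last grid point not to the right of [t]. *)
pose j := Num.truncn ((t + K) / h).
have tK0 : 0 <= (t + K) / h.
  by rewrite divr_ge0 ?(ltW h0)//; move: tK; rewrite ler_norml; lra.
have /andP[j1 j2] := truncn_itv tK0; rewrite -/j in j1 j2.
have tt : `|t - tau j| <= h.
  rewrite ler_pdivlMr// in j1; rewrite ltr_pdivrMr// -natr1 in j2.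
  by rewrite ler_norml /tau; apply/andP; split; lra.
have jN : (j < Ng)%N.
  rewrite ltnS; apply: le_truncn; rewrite ler_pM2r ?invr_gt0//.
  by move: tK; rewrite ler_norml; lra.
(* Since [|t| > del] and the step is at most [del / 2], this grid point carries a genuine affinity
   tilt rather than the zero function. *)
have tj : del / 2 <= `|tau j|.
  have := lerB_normD (tau j) (t - tau j); rewrite addrC.
  have := ler_normD (t - tau j) (tau j); rewrite subrK; lra.
apply: (pick j.+4) => //; rewrite /S /G tj; apply: prod_expR_ge1.
  by rewrite divr_ge0// ltW.
have pw i : rho (x i) - rho (x i - t) <= rho (x i) - rho (x i - tau j) + h.
  have := rho_lipschitz (x i - t) (t - tau j).
  rewrite (_ : x i - t + (t - tau j) = x i - tau j); last by ring.
  by rewrite ler_norml => /andP[_]; lra.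
apply: le_trans (ler_sum _ (fun i _ => pw i)).
by rewrite sumrB subr_ge0.
Qed.

(** Under the new centre the mean log-likelihood ratio per observation is [m * a * e ^+ 2] up to a
    cubic error. A Chernoff factor with a small fixed parameter makes an excess of [eta * e ^+ 2]
    unlikely. *)
Lemma likelihood_ratio_tilt (eta : R) : 0 < eta -> exists k del : R,
  [/\ 0 < k, 0 < del & forall e : R, 0 < e -> e <= del -> exists g,
   tilt m g (1 - k * e ^+ 2) /\
   forall n (z : 'I_n -> R),
     n%:R * ((m * a + eta) * e ^+ 2) <= \sum_(i < n) m * (rho (z i + e) - rho (z i)) ->
     1 <= \prod_(i < n) g (z i)].
Proof.
move=> eta0; have a0 := fisher_gt0 hm; rewrite -/a in a0.
have ma0 : 0 < m * a by rewrite mulr_gt0.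
(* [M * e] bounds the centred increment: [m] comes from the Lipschitz bound on [rho], the rest from
   [e ^+ 2 <= e]. *)
pose M := m + (m * a + eta); have M0 : 0 < M by rewrite !addr_gt0.
(* The first bound keeps the exponent in the range of [expR_taylor1]; the second limits the
   quadratic term to a quarter of [eta]. The cubic term takes another quarter through [del], which
   leaves [eta / 2]. *)
pose k := Num.min (1 / (2 * M)) (eta / (8 * M ^+ 2)).
have k0 : 0 < k by rewrite lt_min !divr_gt0// ?mulr_gt0// exprn_gt0.
have kM : k * M <= 1 / 2.
  have : k <= 1 / (2 * M) by rewrite ge_min lexx.
  by rewrite ler_pdivlMr ?mulr_gt0//; lra.
have kM2 : 2 * k * M ^+ 2 <= eta / 4.
  have : k <= eta / (8 * M ^+ 2) by rewrite ge_min lexx orbT.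
  by rewrite ler_pdivlMr ?mulr_gt0 ?exprn_gt0//; lra.
pose del := Num.min 1 (eta / (12 * m)).
have del0 : 0 < del by rewrite lt_min ltr01 divr_gt0// mulr_gt0.
exists (k * (eta / 2)), del; split; [by rewrite mulr_gt0//; lra|by []|].
move=> e e0 edel.
have e1 : e <= 1 by apply: le_trans edel _; rewrite ge_min lexx.
have em : 3 * m * e <= eta / 4.
  have : e <= eta / (12 * m) by apply: le_trans edel _; rewrite ge_min lexx orbT.
  by rewrite ler_pdivlMr ?mulr_gt0//; lra.
pose b1 := (m * a + eta) * e ^+ 2.
have b10 : 0 <= b1 by rewrite mulr_ge0 ?sqr_ge0// ltW// addr_gt0.
exists (fun z => expR (k * (m * (rho (z + e) - rho z) - b1))); split; last first.
  move=> n z hz; apply: prod_expR_ge1; first exact: ltW.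
  by rewrite sumrB subr_ge0 sumr_const card_ord -mulr_natl.
have e2 : 0 < e ^+ 2 by rewrite exprn_gt0.
apply: (@tilt_le _ _ _ ((1 + k * (m * (3 * e ^+ 3) - b1) + 2 * (k * M * e) ^+ 2) + k * m * e ^+ 2 * a + 0 * (a / (2 * m)))).
  have hh : k * e ^+ 2 * (3 * m * e + 2 * k * M ^+ 2) <= k * e ^+ 2 * (eta / 2).
    by rewrite ler_pM2l ?mulr_gt0//; lra.
  rewrite -subr_ge0; move: hh; rewrite -subr_ge0 => hh; apply: le_trans hh _.
  by rewrite le_eqVlt; apply/orP; left; apply/eqP; rewrite /b1; field; rewrite gt_eqF.
apply: (@tilt_quadratic _ _ hm _ _ (k * m * (2 * e))).
- apply: measurable_comp_expR => z; apply: cvgM; first exact: cvg_cst.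
  apply: cvgB; last exact: cvg_cst.
  apply: cvgM; first exact: cvg_cst.
  apply: cvgB; last exact: rho_continuous.
  have := @comp_affine_continuous _ _ 1 e (@rho_continuous R) z.
  by under [X in continuous_at _ X -> _]eq_fun do rewrite mul1r.
- by move=> z; exact: expR_ge0.
move=> z; set y := k * (m * (rho (z + e) - rho z) - b1).
have yb : `|y| <= k * M * e.
  rewrite /y normrM (gtr0_norm k0) -mulrA ler_pM2l//.
  have := rho_lipschitz z e; rewrite (gtr0_norm e0) => hl.
  apply: le_trans (ler_normB _ _) _; rewrite normrM (gtr0_norm m0) (ger0_norm b10) /M mulrDl.
  apply: lerD; first by rewrite ler_pM2l.
  rewrite /b1 ler_pM2l ?addr_gt0// expr2 -[leRHS]mulr1 ler_pM2l//.
have yb2 : `|y| <= 1 / 2.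
  by apply: le_trans yb _; apply: le_trans kM; rewrite -[leRHS]mulr1 ler_pM2l ?mulr_gt0.
have := expR_taylor1 yb2; rewrite ler_norml => /andP[_ h1].
have y2 : `|y| ^+ 2 <= (k * M * e) ^+ 2 by rewrite lerXn2r// nnegrE// !mulr_ge0// ltW.
have := rho_taylor z e; rewrite (gtr0_norm e0) ler_norml => /andP[_ h2].
have h3 : y <= k * (m * (2 * e * psi z + e ^+ 2 * dpsi z + 3 * e ^+ 3) - b1).
  rewrite /y ler_pM2l// lerD2r ler_pM2l//; lra.
rewrite mul0r addr0; lra.
Qed.

End MleCover.

(** * Tail bounds *)

Section NumericBound.
Variables (R : realType) (m : R).
Hypothesis hm : 1 / 2 < m.
Let b := m * fisher m.

Lemma rate_gt0 : 0 < b.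
Proof. by rewrite mulr_gt0 ?fisher_gt0//; move: hm; lra. Qed.

Lemma exprn_le_expR (u : R) n : 0 <= 1 - u -> (1 - u) ^+ n <= expR (- (n%:R * u)).
Proof.
move=> u1; rewrite -mulrN expRM_natl lerXn2r// ?nnegrE ?expR_ge0//.
exact: expR_ge1Dx.
Qed.

(** Turns the cover into one exponential with rate [b - eta]: half of [eta] absorbs the cubic error,
    the other half the number of terms. *)
Lemma cover_bound (eta : R) : 0 < eta -> exists del B : R, [/\ 0 < del, 0 < B &
  forall e : R, 0 < e -> e <= del -> exists (N : nat) (G : nat -> R -> R) (q : nat -> R),
  [/\ forall j, tilt m (G j) (q j),
      forall n (x : 'I_n -> R) (t : R), is_mle m x t -> e < `|t| ->
        1 <= \sum_(j < N) \prod_(i < n) G j (x i) &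
      forall n, B <= n%:R * e ^+ 2 ->
        \sum_(j < N) q j ^+ n <= expR (- ((b - eta) * (n%:R * e ^+ 2)))]].
Proof.
move=> eta0; have b0 := rate_gt0.
have [d0 [C [N [r [d00 r0 r1 cover]]]]] := mle_cover hm.
(* The third bound gives [C * e <= eta / 2]; the last gives [b * e ^+ 2 <= 1 - r], so that the terms
   [r ^+ n] decay at least as fast as the score terms. *)
pose del := Num.min d0 (Num.min 1 (Num.min (eta / (2 * (`|C| + 1))) ((1 - r) / b))).
have C0 : 0 < `|C| + 1 by rewrite ltr_wpDl.
(* From this threshold on, [N + 2] is at most [expR (eta / 2 * (n * e ^+ 2))]. *)
exists del, (2 * (N%:R + 2) / eta); split.
- by rewrite !lt_min d00 ltr01/= !divr_gt0// ?subr_gt0// mulr_gt0.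
- by rewrite divr_gt0// mulr_gt0// ltr_wpDl.
move=> e e0 edel.
have ed0 : e <= d0 by apply: le_trans edel _; rewrite ge_min lexx.
have e1 : e <= 1 by apply: le_trans edel _; rewrite !ge_min lexx !orbT.
have eC : C * e <= eta / 2.
  have : e <= eta / (2 * (`|C| + 1)) by apply: le_trans edel _; rewrite !ge_min lexx !orbT.
  rewrite ler_pdivlMr ?mulr_gt0// => h.
  have : C * e <= (`|C| + 1) * e.
    by rewrite ler_pM2r//; have := ler_norm C; lra.
  lra.
have er : e ^+ 2 * b <= 1 - r.
  have : e <= (1 - r) / b by apply: le_trans edel _; rewrite !ge_min lexx !orbT.
  rewrite ler_pdivlMr// => h; apply: le_trans h.
  by rewrite ler_pM2r// expr2 -[leRHS]mulr1 ler_pM2l.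
have [G [G0 G1 GS cov]] := cover e e0 ed0.
set q0 := 1 - _ + _ in G0 G1.
exists N.+2, G, (fun j => if (j < 2)%N then q0 else r); split => //.
- by case=> [|[|j]].
move=> n; set s := n%:R * e ^+ 2 => Bs.
rewrite 2!big_ord_recl/= sumr_const card_ord -mulr_natl.
have q00 : 0 <= q0 by exact: tilt_ge0 G0.
have s0 : 0 <= s by rewrite mulr_ge0 ?sqr_ge0.
have hq : q0 ^+ n <= expR (- ((b - eta / 2) * s)).
  have q0E : q0 = 1 - (b * e ^+ 2 - C * e ^+ 3) by rewrite /q0 /b; ring.
  rewrite q0E in q00 *; apply: le_trans (exprn_le_expR _ q00) _.
  rewrite ler_expR lerN2.
  have := ler_wpM2l s0 eC.
  rewrite (_ : n%:R * _ = b * s - s * (C * e)); last by rewrite /s; ring.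
  lra.
have hr : r ^+ n <= expR (- ((b - eta / 2) * s)).
  have rE : r = 1 - (1 - r) by ring.
  rewrite rE; apply: le_trans (exprn_le_expR _ _) _; first by rewrite -rE.
  rewrite ler_expR lerN2.
  have := ler_wpM2l (ler0n R n) er; rewrite mulrA -/s.
  have : 0 <= eta / 2 * s by rewrite mulr_ge0//; lra.
  lra.
apply: (@le_trans _ _ ((N%:R + 2) * expR (- ((b - eta / 2) * s)))).
  have : N%:R * r ^+ n <= N%:R * expR (- ((b - eta / 2) * s)) by rewrite ler_wpM2l.
  lra.
have -> : - ((b - eta) * s) = eta / 2 * s + - ((b - eta / 2) * s) by field.
rewrite expRD ler_pM2r ?expR_gt0//.
apply: le_trans (expR_ge1Dx _).
move: Bs; rewrite ler_pdivrMr//; lra.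
Qed.

End NumericBound.

(** * Markov's inequality and change of centre on the sample space *)

Section Master.
Variables (R : realType) (m : R).
Hypothesis hm : 1 / 2 < m.
Variables (d : measure_display) (T : measurableType d) (P : probability T R).
Variables (X : nat -> T -> R) (theta : R).
Hypothesis mX : forall i, measurable_fun setT (X i).
Hypothesis indX : mutually_independent P X.
Hypothesis lawX : forall i, has_law_PVII P m theta (X i).
Notation f := (pvii_density m).
Let mu := @lebesgue_measure R.

Let mfs (s : R) : measurable_fun setT (fun x : R => f (x - s)).
Proof.
by apply: (measurableT_comp (pvii_density_measurable m)); exact: measurable_funB.
Qed.

Let mshift (g : R -> R) (s : R) : measurable_fun setT g ->
  measurable_fun setT (fun x : R => g (x - s)).
Proof. by move=> mg; apply: (measurableT_comp mg); exact: measurable_funB. Qed.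

Let ratio (s x : R) := f (x - s) / f (x - theta).

Let ratio_ge0 s x : 0 <= ratio s x.
Proof. by rewrite divr_ge0// pvii_density_ge0. Qed.

Let ratioE s x : ratio s x = expR (m * (rho (x - theta) - rho (x - s))).
Proof. exact: pvii_density_ratio. Qed.

Let mratio s : measurable_fun setT (ratio s).
Proof.
rewrite (_ : ratio s = (fun x => expR (m * (rho (x - theta) - rho (x - s))))); last first.
  by apply/funext => x; exact: ratioE.
apply: measurable_comp_expR => x; apply: cvgM; first exact: cvg_cst.
apply: cvgB.
  have := @comp_affine_continuous _ _ 1 (- theta) (@rho_continuous R) x.
  by under [X in continuous_at _ X -> _]eq_fun do rewrite mul1r.
have := @comp_affine_continuous _ _ 1 (- s) (@rho_continuous R) x.
by under [X in continuous_at _ X -> _]eq_fun do rewrite mul1r.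
Qed.

(** A product of [g] over the sample recentred at [s], weighted by the likelihood ratio. Its
    expectation under [P] is the one the product would have if the centre were [s], so no second
    probability space is introduced. *)
Let lik (g : R -> R) (s : R) n w := \prod_(i < n) (ratio s (X i w) * g (X i w - s)).

Let lik_ge0 (g : R -> R) s n w : (forall x, 0 <= g x) -> 0 <= lik g s n w.
Proof. by move=> g0; apply: prodr_ge0 => i _; rewrite mulr_ge0. Qed.

Let mlik (g : R -> R) s n : measurable_fun setT g -> measurable_fun setT (lik g s n).
Proof.
move=> mg; apply: measurable_prod => i _.
apply: measurable_funM; first exact: (measurableT_comp (mratio s) (mX i)).
exact: (measurableT_comp (mshift s mg) (mX i)).
Qed.

Let lik_expectation (g : R -> R) s n (q : R) : measurable_fun setT g -> (forall x, 0 <= g x) ->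
  (\int[mu]_x (g x * f x)%:E = q%:E)%E ->
  (\int[P]_w (lik g s n w)%:E = (q ^+ n)%:E)%E.
Proof.
move=> mg g0 gq.
apply: (@product_formula _ _ _ P X (fun x => f (x - theta)) mX (mfs theta) _ indX _
  (fun x => ratio s x * g (x - s)) q n).
- by move=> x; exact: pvii_density_ge0.
- by move=> i B mB; exact: lawX.
- by apply: measurable_funM => //; exact: mshift.
- by move=> x; rewrite mulr_ge0.
rewrite -gq -(@ge0_integral_shift _ s (fun x => g x * f x)).
- apply: eq_integral => x _; congr EFin; rewrite /ratio.
  have := pvii_density_gt0 hm (x - theta) => fx.
  by field; rewrite gt_eqF.
- by apply: measurable_funM => //; exact: pvii_density_measurable.
- by move=> x; rewrite mulr_ge0// pvii_density_ge0.
Qed.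

Let lik_tilt (g : R -> R) s n (q : R) : tilt m g q -> (\int[P]_w (lik g s n w)%:E <= (q ^+ n)%:E)%E.
Proof.
move=> [mg g0 gq].
have I0 : (0 <= \int[mu]_x (g x * f x)%:E)%E.
  by apply: integral_ge0 => x _; rewrite lee_fin mulr_ge0// pvii_density_ge0.
have fin : (\int[mu]_x (g x * f x)%:E)%E \is a fin_num.
  by rewrite ge0_fin_numE// (le_lt_trans gq)// ltry.
rewrite (@lik_expectation g s n (fine (\int[mu]_x (g x * f x)%:E)%E))// ?fineK//.
rewrite lee_fin lerXn2r// ?nnegrE ?fine_ge0//.
  by rewrite -lee_fin (le_trans I0).
by rewrite -lee_fin fineK.
Qed.

Let lik1E s n w : lik (cst 1) s n w = \prod_(i < n) ratio s (X i w).
Proof. by apply: eq_bigr => i _; rewrite mulr1. Qed.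

Let lik1_expectation s n : (\int[P]_w (lik (cst 1) s n w)%:E = 1)%E.
Proof. by rewrite (@lik_expectation _ s n 1) ?expr1n//; exact: (mean_one hm).2. Qed.

Let likM (g : R -> R) s n w : lik g s n w = \prod_(i < n) ratio s (X i w) * \prod_(i < n) g (X i w - s).
Proof. by rewrite /lik big_split. Qed.

Let sum_lik N (G : nat -> R -> R) (q : nat -> R) s n : (forall j, tilt m (G j) (q j)) ->
  (\int[P]_w (\sum_(j < N) lik (G j) s n w)%:E <= (\sum_(j < N) q j ^+ n)%:E)%E.
Proof.
move=> tG.
apply: (@le_trans _ _ (\int[P]_w (\sum_(j < N) (lik (G j) s n w)%:E))%E).
  by rewrite le_eqVlt; apply/orP; left; apply/eqP/eq_integral => w _; rewrite sumEFin.
rewrite ge0_integral_sum//.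
- by rewrite -sumEFin; apply: lee_sum => j _; exact: lik_tilt.
- by move=> j; apply/measurable_EFinP/mlik; have [] := tG j.
- by move=> j w _; rewrite lee_fin lik_ge0//; have [] := tG j.
Qed.

(** Markov's inequality: the indicator of [A] is below the sum of products, taken at [s = theta],
    where the likelihood ratio is 1. *)
Lemma master_upper N (G : nat -> R -> R) (q : nat -> R) n (A : set T) :
  measurable A -> (forall j, tilt m (G j) (q j)) ->
  (forall w, A w -> 1 <= \sum_(j < N) \prod_(i < n) G j (X i w - theta)) ->
  (P A <= (\sum_(j < N) q j ^+ n)%:E)%E.
Proof.
move=> mA tG cov.
have G0 j x : 0 <= G j x by have [] := tG j.
rewrite -(setIT A) -integral_indic//; apply: le_trans (sum_lik N theta n tG).
have likE j w : lik (G j) theta n w = \prod_(i < n) G j (X i w - theta).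
  rewrite /lik; apply: eq_bigr => i _; rewrite /ratio divff ?mul1r// gt_eqF//.
  exact: pvii_density_gt0.
apply: ge0_le_integral => //=.
- exact/measurable_EFinP.
- by apply/measurable_EFinP; apply: measurable_sum => j; apply: mlik; have [] := tG j.
move=> w _; rewrite lee_fin indicE; case: (boolP (w \in A)) => [|_].
  by rewrite inE => /cov/le_trans; apply; apply: ler_sum => j _; rewrite likE.
by apply: sumr_ge0 => j _; exact: lik_ge0.
Qed.

(* Change of measure: the likelihood ratio turns the law centred at [theta] into the one
   centred at [s]; on [A] it is at most [expR beta], outside it is paid for by the cover. *)
Lemma master_lower N (G : nat -> R -> R) (q : nat -> R) n (A : set T) (s beta : R) :
  measurable A -> (forall j, tilt m (G j) (q j)) ->
  (forall w, (A w /\ \sum_(i < n) m * (rho (X i w - theta) - rho (X i w - s)) <= beta) \/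
     1 <= \sum_(j < N) \prod_(i < n) G j (X i w - s)) ->
  ((expR (- beta) * (1 - \sum_(j < N) q j ^+ n))%:E <= P A)%E.
Proof.
move=> mA tG cov.
have G0 j x : 0 <= G j x by have [] := tG j.
pose L w := \prod_(i < n) ratio s (X i w).
have LE w : L w = expR (\sum_(i < n) m * (rho (X i w - theta) - rho (X i w - s))).
  by rewrite expR_sum; apply: eq_bigr => i _; exact: ratioE.
have msum : measurable_fun setT (fun w => \sum_(j < N) lik (G j) s n w).
  by apply: measurable_sum => j; apply: mlik; have [] := tG j.
have sum0 w : 0 <= \sum_(j < N) lik (G j) s n w.
  by apply: sumr_ge0 => j _; exact: lik_ge0.
have pw w : expR (- beta) * lik (cst 1) s n w <=
    \1_A w + expR (- beta) * \sum_(j < N) lik (G j) s n w.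
  rewrite lik1E -/(L w).
  have L0 : 0 < L w by rewrite LE expR_gt0.
  case: (cov w) => [[Aw Lb]|c].
    rewrite indicE mem_set//= -[leLHS]addr0 lerD//; last by rewrite mulr_ge0// expR_ge0.
    by rewrite LE -expRD expR_le1; lra.
  rewrite -[leLHS]add0r lerD// ler_pM2l ?expR_gt0//.
  under eq_bigr do rewrite likM -/(L w).
  by rewrite -mulr_sumr -[leLHS]mulr1 ler_pM2l.
have e0 : 0 <= expR (- beta) by exact: expR_ge0.
have I1 : ((expR (- beta))%:E <= P A + (expR (- beta) * \sum_(j < N) q j ^+ n)%:E)%E.
  have -> : ((expR (- beta))%:E = \int[P]_w ((expR (- beta))%:E * (lik (cst 1) s n w)%:E))%E.
    rewrite ge0_integralZl_EFin//.
    + by rewrite lik1_expectation mule1.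
    + by move=> w _; rewrite lee_fin lik_ge0//= => x; exact: ler01.
    + by apply/measurable_EFinP; exact: mlik.
  apply: (@le_trans _ _ (\int[P]_w ((\1_A w)%:E +
      (expR (- beta))%:E * (\sum_(j < N) lik (G j) s n w)%:E))%E).
    apply: ge0_le_integral => //=.
    + by move=> w _; rewrite mule_ge0// lee_fin lik_ge0//= => x; exact: ler01.
    + by apply: measurable_funeM; apply/measurable_EFinP; exact: mlik.
    + apply: emeasurable_funD; first exact/measurable_EFinP.
      by apply: measurable_funeM; exact/measurable_EFinP.
    + by move=> w _; rewrite -!EFinM -EFinD lee_fin.
  rewrite ge0_integralD//; first last.
  + by apply: measurable_funeM; exact/measurable_EFinP.
  + by move=> w _; rewrite mule_ge0// lee_fin.
  + exact/measurable_EFinP.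
  rewrite integral_indic// setIT leeD2l//.
  rewrite ge0_integralZl_EFin//; last 2 first.
  + by move=> w _; rewrite lee_fin.
  + exact/measurable_EFinP.
  by rewrite EFinM; apply: lee_wpmul2l => //; exact: sum_lik.
by rewrite mulrBr mulr1 EFinB leeBlDr.
Qed.

End Master.

(** * Two-sided exponential bounds for the estimator *)

Section Rate.
Variables (R : realType) (m : R).
Hypothesis hm : 1 / 2 < m.
Variables (d : measure_display) (T : measurableType d) (P : probability T R).
Variables (X : nat -> T -> R) (theta : R) (mle : forall n : nat, ('I_n -> R) -> R).
Hypothesis mX : forall i, measurable_fun setT (X i).
Hypothesis indX : mutually_independent P X.
Hypothesis lawX : forall i, has_law_PVII P m theta (X i).
Hypothesis mmle : forall n, Rn_borel_measurable (@mle n).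
Hypothesis mleP : forall n (x : 'I_n -> R), is_mle m x (mle x).
Let b := m * fisher m.
Let Xn n w := fun i : 'I_n => X i w.
Let dev n (e : R) := [set w | e < `|mle (@Xn n w) - theta|].

(** The sets with measurable preimage form a sigma-algebra containing the generating boxes. *)
Lemma sample_measurable n (B : set ('I_n -> R)) : Rn_borel B -> measurable (@Xn n @^-1` B).
Proof.
pose M := [set B : set ('I_n -> R) | measurable (@Xn n @^-1` B)].
apply: (@smallest_sub _ _ _ M) => [|_ [C mC <-]]; last first.
  rewrite /M/= (_ : _ @^-1` _ = \bigcap_(i in [set: 'I_n]) (X i @^-1` C i)); last first.
    by apply/seteqP; split => w h i; [move=> _; exact: h|exact: (h i Logic.I)].
  apply: fin_bigcap_measurable; first exact: finite_finset.
  by move=> i _; rewrite -[_ @^-1` _]setTI; exact: mX.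
split.
- by rewrite /M/= preimage_set0; exact: measurable0.
- move=> A mA; rewrite /M/= setTD preimage_setC; exact: measurableC.
- move=> F mF; rewrite /M/= preimage_bigcup; by apply: bigcup_measurable => k _; exact: mF.
Qed.

Lemma dev_measurable n e : measurable (dev n e).
Proof.
pose S := [set t : R | e < `|t - theta|].
have mS : measurable S.
  have mf : measurable_fun setT (fun t : R => `|t - theta|).
    by apply: measurableT_comp => //; exact: measurable_funB.
  rewrite (_ : S = (fun t : R => `|t - theta|) @^-1` `]e, +oo[%classic); last first.
    by apply/seteqP; split => t /=; rewrite in_itv/= andbT.
  rewrite -[_ @^-1` _]setTI; apply: mf => //; exact: measurable_itv.
exact: (sample_measurable (mmle mS)).
Qed.

(** Translation equivariance: the cover, stated for errors around 0, applies around [theta] as well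
    as around the shifted centre. *)
Lemma is_mle_shift n (x : 'I_n -> R) (t s : R) : is_mle m x t ->
  is_mle m (fun i => x i - s) (t - s).
Proof.
move=> h u; have := h (s + u).
rewrite (eq_bigr (fun i => pvii_density m (x i - s - u))) => [|i _]; last first.
  by rewrite opprD addrA.
by rewrite [leRHS](eq_bigr (fun i => pvii_density m (x i - s - (t - s)))) // => i _; rewrite opprB addrA subrK.
Qed.

Lemma mle_rate_upper (eta : R) : 0 < eta -> exists del B : R, [/\ 0 < del, 0 < B &
  forall n e, 0 < e -> e <= del -> B <= n%:R * e ^+ 2 ->
  (P (dev n e) <= (expR (- ((b - eta) * (n%:R * e ^+ 2))))%:E)%E].
Proof.
move=> eta0; have [del [B [del0 B0 cov]]] := cover_bound hm eta0.
exists del, B; split => // n e e0 edel Bn.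
have [N [G [q [tG covG qB]]]] := cov e e0 edel.
apply: (@le_trans _ _ (\sum_(j < N) q j ^+ n)%:E); last by rewrite lee_fin qB.
apply: (master_upper hm mX indX lawX (dev_measurable n e) tG) => w hw.
by apply: covG hw; exact: is_mle_shift.
Qed.

Let expR_small (u : R) : 3 <= u -> expR (- u) <= 1 / 4.
Proof.
move=> u3; have := expR_ge1Dx u; rewrite expRN => h.
rewrite -[leRHS]invrK lef_pV2 ?posrE ?expR_gt0 ?invr_gt0//; lra.
Qed.

Lemma mle_rate_lower (eta : R) : 0 < eta -> exists del B : R, [/\ 0 < del, 0 < B &
  forall n e, 0 < e -> e <= del -> B <= n%:R * e ^+ 2 ->
  ((expR (- ((b + eta) * (n%:R * e ^+ 2))))%:E <= P (dev n e))%E].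
Proof.
move=> eta0; have b0 : 0 < b := rate_gt0 hm.
(* The single slack [h] is used for the shift of the centre, for the likelihood ratio and for a
   final factor [1 / 2]; [hb] records that their total cost fits in [eta]. *)
pose h := Num.min 1 (eta / (5 + 3 * b)).
have h0 : 0 < h by rewrite lt_min ltr01 divr_gt0//; lra.
have h1 : h <= 1 by rewrite ge_min lexx.
have heta : h * (5 + 3 * b) <= eta.
  have : h <= eta / (5 + 3 * b) by rewrite ge_min lexx orbT.
  by rewrite ler_pdivlMr//; lra.
have hb : (b + h) * (1 + h) ^+ 2 + h <= b + eta.
  have hh : h ^+ 2 <= h by rewrite expr2 -[leRHS]mulr1 ler_pM2l.
  have s1 : (1 + h) ^+ 2 <= 1 + 3 * h by rewrite sqrrD; lra.
  have : (b + h) * (1 + h) ^+ 2 <= (b + h) * (1 + 3 * h) by rewrite ler_pM2l//; lra.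
  lra.
have [k [d1 [k0 d10 lr]]] := likelihood_ratio_tilt hm h0.
(* Under the shifted law any positive rate suffices, so half of [b] is given away. *)
have b2 : 0 < b / 2 by lra.
have [d2 [B2 [d20 B20 cov]]] := cover_bound hm b2.
(* The four summands secure [sa], [sb], [sc] and [sd] in turn; the first two make each exceptional
   probability at most [1 / 4]. *)
pose B := 3 / k + (24 / (b * h ^+ 2) + (4 * B2 / h ^+ 2 + 1 / h)).
have bh : 0 < b * h ^+ 2 by rewrite mulr_gt0 ?exprn_gt0.
have hh0 : 0 < h ^+ 2 by rewrite exprn_gt0.
have Ba : 0 < 3 / k by rewrite divr_gt0.
have Bb : 0 < 24 / (b * h ^+ 2) by rewrite divr_gt0.
have Bc : 0 < 4 * B2 / h ^+ 2 by rewrite divr_gt0// mulr_gt0.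
have Bd : 0 < 1 / h by rewrite divr_gt0.
exists (Num.min (d1 / 2) d2), B; split; first by rewrite lt_min d20 divr_gt0.
  by rewrite /B !addr_gt0.
move=> n e e0 edel; set s := n%:R * e ^+ 2 => Bs.
have ed1 : e <= d1 / 2 by apply: le_trans edel _; rewrite ge_min lexx.
have ed2 : e <= d2 by apply: le_trans edel _; rewrite ge_min lexx orbT.
have sa : 3 <= k * s by rewrite -ler_pdivrMl// mulrC; rewrite /B in Bs; lra.
have sb : 3 <= b / 2 * (s * h ^+ 2 / 4).
  have : 24 / (b * h ^+ 2) <= s by rewrite /B in Bs; lra.
  by rewrite ler_pdivrMr//; lra.
have sc : B2 <= s * h ^+ 2 / 4.
  have : 4 * B2 / h ^+ 2 <= s by rewrite /B in Bs; lra.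
  by rewrite ler_pdivrMr//; lra.
have sd : 1 <= s * h.
  have : 1 / h <= s by rewrite /B in Bs; lra.
  by rewrite ler_pdivrMr.
have s0 : 0 <= s by rewrite mulr_ge0 ?sqr_ge0.
(* The new centre is [theta + e1]. An estimator within [e] of [theta] misses it by at least [h * e],
   which is strictly more than [e2]. *)
pose e1 := (1 + h) * e; pose e2 := h * e / 2.
have e10 : 0 < e1 by rewrite mulr_gt0//; lra.
have e20 : 0 < e2 by rewrite divr_gt0 ?mulr_gt0.
have he : h * e <= e by rewrite -[leRHS]mul1r ler_pM2r.
have [g [tg gP]] := lr e1 e10 ltac:(rewrite /e1; lra).
have [N [G [q [tG covG qB]]]] := cov e2 e20 ltac:(rewrite /e2; lra).
(* One family covers both exceptional events: a large likelihood ratio by [g], a large error around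
   the new centre by [G]. *)
pose G' j := if j is j'.+1 then G j' else g.
pose q' j := if j is j'.+1 then q j' else 1 - k * e1 ^+ 2.
have tG' j : tilt m (G' j) (q' j) by case: j.
pose beta := n%:R * ((b + h) * e1 ^+ 2).
have betaE : beta = (b + h) * (1 + h) ^+ 2 * s by rewrite /beta /e1 /s; ring.
have G'0 j x : 0 <= G' j x by have [] := tG' j.
have G'prod0 j w : 0 <= \prod_(i < n) G' j (X i w - (theta + e1)) by exact: prodr_ge0.
have key : ((expR (- beta) * (1 - \sum_(j < N.+1) q' j ^+ n))%:E <= P (dev n e))%E.
  apply: (master_lower (s := theta + e1) hm mX indX lawX (dev_measurable n e) tG') => w.
  have [hw|hw] := leP (\sum_(i < n) m * (rho (X i w - theta) - rho (X i w - (theta + e1)))) beta.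
    have [A|A] := ltP e `|mle (@Xn n w) - theta|; [by left|right].
    rewrite big_ord_recl/= -[leLHS]add0r lerD//; first exact: (G'prod0 0%N).
    have ml := is_mle_shift (theta + e1) (mleP (@Xn n w)).
    apply: (covG _ _ _ ml); move: A; rewrite ler_norml => /andP[_ A].
    rewrite ltr_normr; apply/orP; right; rewrite /e2.
    have : h * e > 0 by rewrite mulr_gt0.
    by rewrite /e1; lra.
  right; rewrite big_ord_recl/= -[leLHS]addr0 lerD//; last first.
    by apply: sumr_ge0 => j _; exact: (G'prod0 j.+1).
  apply: gP; apply: le_trans (ltW hw) _; rewrite le_eqVlt; apply/orP; left; apply/eqP.
  by apply: eq_bigr => i _; congr (m * (rho _ - _)); ring.
apply: le_trans key; rewrite lee_fin.
have q1 : (1 - k * e1 ^+ 2) ^+ n <= 1 / 4.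
  have q00 : 0 <= 1 - k * e1 ^+ 2 by exact: tilt_ge0 tg.
  apply: le_trans (exprn_le_expR n q00) _; apply: expR_small; apply: le_trans sa _.
  rewrite /s mulrCA ler_wpM2l// ler_pM2l// lerXn2r// ?nnegrE ?(ltW e0) ?(ltW e10)//.
  by rewrite /e1; have := mulr_gt0 h0 e0; lra.
have e2E : n%:R * e2 ^+ 2 = s * h ^+ 2 / 4 by rewrite /e2 /s; field.
have q2 : \sum_(j < N) q j ^+ n <= 1 / 4.
  have := qB n; rewrite e2E => /(_ sc)/le_trans; apply.
  by apply: expR_small; rewrite (_ : b - b / 2 = b / 2)//; field.
have qs : 1 / 2 <= 1 - \sum_(j < N.+1) q' j ^+ n.
  by rewrite big_ord_recl/=; lra.
apply: (@le_trans _ _ (expR (- beta) * (1 / 2))); last by rewrite ler_pM2l ?expR_gt0.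
(* The remaining probability [1 / 2] is absorbed into the exponent as [s * h]. *)
have eh : expR (- (s * h)) <= 1 / 2.
  have := expR_ge1Dx (s * h); rewrite expRN => hx.
  rewrite -[leRHS]invrK lef_pV2 ?posrE ?expR_gt0 ?invr_gt0//; lra.
apply: (@le_trans _ _ (expR (- beta) * expR (- (s * h)))); last by rewrite ler_pM2l ?expR_gt0.
rewrite -expRD ler_expR -opprD lerN2 betaE.
have := ler_wpM2r s0 hb; rewrite mulrDl (mulrC h); lra.
Qed.

Lemma mle_rate (eta : R) : 0 < eta -> exists del B : R, [/\ 0 < del, 0 < B &
  forall n e, 0 < e -> e <= del -> B <= n%:R * e ^+ 2 ->
  ((- ((b + eta) * (n%:R * e ^+ 2)))%:E <= lne (P (dev n e)) <=
   (- ((b - eta) * (n%:R * e ^+ 2)))%:E)%E].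
Proof.
move=> eta0.
have [d1 [B1 [d10 B10 up]]] := mle_rate_upper eta0.
have [d2 [B2 [d20 B20 lo]]] := mle_rate_lower eta0.
exists (Num.min d1 d2), (B1 + B2); split; [by rewrite lt_min d10|by rewrite addr_gt0|].
move=> n e e0; rewrite le_min => /andP[ed1 ed2] Bn.
have := up n e e0 ed1 ltac:(lra); have := lo n e e0 ed2 ltac:(lra).
have lneE (y : R) : lne (expR y)%:E = y%:E by rewrite lne_EFin ?expR_gt0// expRK.
have in01 (x : \bar R) : (0 <= x)%E -> x \in `[0, +oo]%E by rewrite in_itv/= leey andbT.
move=> hlo hup; rewrite -[X in (X <= _ <= _)%E]lneE -[X in (_ <= _ <= X)%E]lneE.
by rewrite !lee_lne ?in01 ?measure_ge0 ?lee_fin ?expR_ge0// hlo.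
Qed.

End Rate.

(** * Limits *)

Section Limits.
Variable R : realType.
Local Open Scope ereal_scope.

Lemma limf_esup_le (T : choiceType) (X : filteredType T) (u : X -> \bar R)
    (F : set (set X)) (V : set X) (l : \bar R) :
  F V -> (forall x, V x -> u x <= l) -> limf_esup u F <= l.
Proof.
move=> FV h; rewrite limf_esupE; apply: (@le_trans _ _ (ereal_sup (u @` V))).
  by apply: ereal_inf_lbound; exists V.
by apply: ge_ereal_sup => _ [x Vx <-]; exact: h.
Qed.

Lemma limf_einf_ge (T : choiceType) (X : filteredType T) (u : X -> \bar R)
    (F : set (set X)) (V : set X) (l : \bar R) :
  F V -> (forall x, V x -> l <= u x) -> l <= limf_einf u F.
Proof.
move=> FV h; rewrite limf_einfE; apply: (@le_trans _ _ (ereal_inf (u @` V))).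
  by apply: le_ereal_inf_tmp => _ [x Vx <-]; exact: h.
by apply: ereal_sup_ubound; exists V.
Qed.

Lemma near_at_right0 (del : R) : (0 < del)%R ->
  (0%R : R)^'+ [set e : R | (0 < e <= del)%R].
Proof.
move=> d0; near=> e; apply/andP; split; first by near: e; exact: nbhs_right_gt.
by near: e; exact: nbhs_right_le.
Unshelve. all: by end_near. Qed.

(* Two-sided quadratic bounds on the logarithm, uniform once [n e^2] is large, contain
   both the iterated limit and the moderate deviation limit. *)
Section QuadraticRate.
Variables (pr : nat -> R -> \bar R) (b : R).
Hypothesis quad : forall eta : R, (0 < eta)%R -> exists del B : R, [/\ (0 < del)%R, (0 < B)%R &
  forall n e, (0 < e)%R -> (e <= del)%R -> (B <= n%:R * e ^+ 2)%R ->
  (- ((b + eta) * (n%:R * e ^+ 2)))%:E <= lne (pr n e) <=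
   (- ((b - eta) * (n%:R * e ^+ 2)))%:E].

Let near_large (B e : R) : (0 < B)%R -> (0 < e)%R ->
  \oo [set n | (0 < n)%N && (B <= n%:R * e ^+ 2)%R].
Proof.
move=> B0 e0; near=> n; apply/andP; split; first by near: n; exact: nbhs_infty_gt.
rewrite -ler_pdivrMr ?exprn_gt0//.
by near: n; exact: nbhs_infty_ger.
Unshelve. all: by end_near. Qed.

Lemma quadratic_limsup :
  limf_esup (fun e : R => (e ^- 2)%:E *
    limn_esup (fun n : nat => lne (pr n e) * (n%:R^-1)%:E)) 0^'+ <= (- b)%:E.
Proof.
apply/lee_addgt0Pr => eta eta0; have [del [B [d0 B0 h]]] := quad eta0.
apply: (limf_esup_le (near_at_right0 d0)) => e /= /andP[e0 ed].
have e2 : (0 < e ^+ 2)%R by rewrite exprn_gt0.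
apply: (@le_trans _ _ ((e ^- 2)%:E * (- (b - eta) * e ^+ 2)%:E)).
  apply: lee_wpmul2l; first by rewrite lee_fin invr_ge0 ltW.
  apply: (limf_esup_le (near_large B0 e0)) => n /= /andP[n0 Bn].
  have n0' : (0 < n%:R :> R)%R by rewrite ltr0n.
  have /andP[_ hn] := h n e e0 ed Bn.
  apply: (@le_trans _ _ ((- ((b - eta) * (n%:R * e ^+ 2)))%:E * (n%:R^-1)%:E)).
    by apply: lee_wpmul2r => //; rewrite lee_fin invr_ge0.
  rewrite -EFinM lee_fin le_eqVlt; apply/orP; left; apply/eqP.
  by field; rewrite gt_eqF.
rewrite -EFinM -EFinD lee_fin le_eqVlt; apply/orP; left; apply/eqP.
by field; rewrite gt_eqF.
Qed.

Lemma quadratic_liminf :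
  (- b)%:E <= limf_einf (fun e : R => (e ^- 2)%:E *
    limn_einf (fun n : nat => lne (pr n e) * (n%:R^-1)%:E)) 0^'+.
Proof.
apply/lee_addgt0Pr => eta eta0; have [del [B [d0 B0 h]]] := quad eta0.
rewrite -leeBlDr//.
apply: (limf_einf_ge (near_at_right0 d0)) => e /= /andP[e0 ed].
have e2 : (0 < e ^+ 2)%R by rewrite exprn_gt0.
apply: (@le_trans _ _ ((e ^- 2)%:E * (- (b + eta) * e ^+ 2)%:E)).
  rewrite -EFinM -EFinB lee_fin le_eqVlt; apply/orP; left; apply/eqP.
  by field; rewrite gt_eqF.
apply: lee_wpmul2l; first by rewrite lee_fin invr_ge0 ltW.
apply: (limf_einf_ge (near_large B0 e0)) => n /= /andP[n0 Bn].
have n0' : (0 < n%:R :> R)%R by rewrite ltr0n.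
have /andP[hn _] := h n e e0 ed Bn.
apply: (@le_trans _ _ ((- ((b + eta) * (n%:R * e ^+ 2)))%:E * (n%:R^-1)%:E)).
  rewrite -EFinM lee_fin le_eqVlt; apply/orP; left; apply/eqP.
  by field; rewrite gt_eqF.
by apply: lee_wpmul2r => //; rewrite lee_fin invr_ge0.
Qed.

(** Take [e = eps / lam n]: it tends to 0 because [lam] diverges, while [n * e ^+ 2] tends to
    infinity because [lam n] is negligible against the square root of [n]. *)
Lemma quadratic_moderate (lam : nat -> R) (eps : R) :
  (forall n, (0 < lam n)%R) -> lam n @[n --> \oo] --> +oo%R ->
  (lam n / Num.sqrt n%:R)%R @[n --> \oo] --> (0 : R)%R -> (0 < eps)%R ->
  lne (pr n (eps / lam n)%R) * ((n%:R / lam n ^+ 2)^-1)%R%:E @[n --> \oo]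
    --> (- b * eps ^+ 2)%:E.
Proof.
move=> lam0 lamy lamn eps0; have eps2 : (0 < eps ^+ 2)%R by rewrite exprn_gt0.
have near_bound (eta : R) : (0 < eta)%R -> \forall n \near \oo,
    ((- b * eps ^+ 2 - eta)%:E <= lne (pr n (eps / lam n)%R) * ((n%:R / lam n ^+ 2)^-1)%R%:E <=
     (- b * eps ^+ 2 + eta)%:E).
  move=> eta0; have eta0' : (0 < eta / eps ^+ 2)%R by rewrite divr_gt0.
  have [del [B [d0 B0 h]]] := quad eta0'.
  (* Once [lam n] is at most [c] times the square root of [n], [n * e ^+ 2] is at least
     [(B + 1) ^+ 2], hence at least [B]. *)
  pose c := (eps / (B + 1))%R; have c0 : (0 < c)%R by rewrite divr_gt0// ltr_wpDl// ltW.
  near=> n.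
  have n0 : (0 < n%:R :> R)%R by rewrite ltr0n; near: n; exact: nbhs_infty_gt.
  have ld : (eps / lam n <= del)%R.
    rewrite ler_pdivrMr// mulrC -ler_pdivrMr//; near: n.
    by move/cvgryPge: lamy; apply.
  have lc : (lam n <= c * Num.sqrt n%:R)%R.
    rewrite -ler_pdivrMr ?sqrtr_gt0//; near: n.
    move/cvgr0Pnorm_le: lamn => /(_ c c0); apply: filterS => n; apply: le_trans.
    exact: ler_norm.
  have l2 : (0 < lam n ^+ 2)%R by rewrite exprn_gt0.
  have Bn : (B <= n%:R * (eps / lam n) ^+ 2)%R.
    rewrite expr_div_n mulrA ler_pdivlMr//.
    have : (lam n ^+ 2 <= c ^+ 2 * n%:R)%R.
      rewrite -[in leRHS](@sqr_sqrtr _ n%:R)// -exprMn lerXn2r ?nnegrE//; first exact: ltW.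
      by rewrite mulr_ge0 ?sqrtr_ge0// ltW.
    move=> /(ler_wpM2l (ltW B0))/le_trans; apply.
    rewrite mulrA mulrC ler_pM2l// /c expr_div_n mulrA ler_pdivrMr; last first.
      by rewrite exprn_gt0// ltr_wpDl// ltW.
    by rewrite mulrC ler_pM2l//; nra.
  have e0 : (0 < eps / lam n)%R by rewrite divr_gt0.
  have /andP[h1 h2] := h n _ e0 ld Bn.
  have k0 : 0 <= ((n%:R / lam n ^+ 2)^-1)%R%:E.
    by rewrite lee_fin invr_ge0 divr_ge0// ltW.
  have := lee_wpmul2r k0 h1; have := lee_wpmul2r k0 h2; rewrite -!EFinM => h3 h4.
  have E (s : R) : (- ((b + s) * (n%:R * (eps / lam n) ^+ 2)) * (n%:R / lam n ^+ 2)^-1 =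
     - b * eps ^+ 2 - s * eps ^+ 2)%R.
    by field; rewrite gt_eqF//= gt_eqF.
  apply/andP; split.
    by apply: le_trans h4; rewrite E lee_fin divfK// gt_eqF.
  apply: (le_trans h3); rewrite -[(b - _)%R]/(b + (- (eta / eps ^+ 2)))%R E lee_fin.
  by rewrite (mulNr (eta / _)) opprK divfK// gt_eqF.
(* Convergence in the extended reals: the terms are eventually finite, by [near_bound] with
   tolerance 1, and their real values converge. *)
apply/fine_cvgP; split.
  near=> n.
  have /andP[h1 h2] : ((- b * eps ^+ 2 - 1)%:E <=
    lne (pr n (eps / lam n)%R) * ((n%:R / lam n ^+ 2)^-1)%R%:E <= (- b * eps ^+ 2 + 1)%:E).
    by near: n; exact: near_bound.
  by rewrite fin_numE -ltNye -ltey (lt_le_trans _ h1) ?(le_lt_trans h2) ?ltNyr ?ltry.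
apply/cvgrPdist_le => eta eta0; near=> n.
have /andP[] : ((- b * eps ^+ 2 - eta)%:E <=
    lne (pr n (eps / lam n)%R) * ((n%:R / lam n ^+ 2)^-1)%R%:E <= (- b * eps ^+ 2 + eta)%:E).
  by near: n; exact: near_bound.
rewrite /=; case: (lne _ * _) => //= r; rewrite !lee_fin => h1 h2.
by rewrite ler_norml; apply/andP; split; lra.
Unshelve. all: by end_near. Qed.

End QuadraticRate.
End Limits.

Theorem theorem1p4 (R : realType) (m : R) (hm : 1 / 2 < m)
    (d : measure_display) (T : measurableType d) (P : probability T R)
    (X : nat -> T -> R) (theta : R) (mle : forall n : nat, ('I_n -> R) -> R) :
  (forall i, measurable_fun setT (X i)) ->
  mutually_independent P X ->
  (forall i, has_law_PVII P m theta (X i)) ->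
  (forall n, Rn_borel_measurable (mle n)) ->
  (forall n (x : 'I_n -> R), is_mle m x (mle n x)) ->
  let pr (n : nat) (eps : R) :=
    P [set w | eps < `|mle n (fun i : 'I_n => X i w) - theta|] in
  let rate : R := - (m * (2 * m - 1) / (2 * (m + 1))) in
  ((limf_esup (fun eps : R => (eps ^- 2)%:E *
        limn_esup (fun n : nat => lne (pr n eps) * (n%:R^-1)%:E))%E 0^'+
      <= rate%:E)%E
   /\ (rate%:E <=
      limf_einf (fun eps : R => (eps ^- 2)%:E *
        limn_einf (fun n : nat => lne (pr n eps) * (n%:R^-1)%:E))%E 0^'+)%E)
  /\
  (forall lam : nat -> R,
     (forall n, 0 < lam n) ->
     lam n @[n --> \oo] --> +oo ->
     (lam n / Num.sqrt n%:R) @[n --> \oo] --> 0 ->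
     forall eps : R, 0 < eps ->
     (lne (pr n (eps / lam n)%R) * ((n%:R / lam n ^+ 2)^-1)%R%:E)%E @[n --> \oo]
       --> (rate * eps ^+ 2)%:E).
Proof.
move=> mX indX lawX mmle mleP pr rate.
have -> : rate = - (m * fisher m) by rewrite /rate /fisher mulrA.
have quad := @mle_rate R m hm d T P X theta mle mX indX lawX mmle mleP.
split; first by split; [exact: (quadratic_limsup quad)|exact: (quadratic_liminf quad)].
by move=> lam lam0 lamy lamn eps eps0; exact: (quadratic_moderate quad lam0 lamy lamn eps0).
Qed.
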